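(* There exist $(\chi^0,\chi^1)\in\mathcal{D}(\mathbb{R}^d)\times\mathcal{D}(\mathbb{R}^d)$ satisfying the moment-wise decomposition factorization property (MDFP).
   Context: $\mathbb{N}=\{0,1,2,\dots\}$; $\mathcal{D}=\mathcal{D}(\mathbb{R}^d)$ is the space of compactly supported smooth functions on $\mathbb{R}^d$. For compact $K\subset\mathbb{R}^d$, $\mathcal{D}(K)$ is the space of smooth functions supported in $K$, and for $L\in\mathbb{N}$, $\mathcal{D}_L(K):=\{\varphi\in\mathcal{D}(K):\int_{\mathbb{R}^d}x^\alpha\varphi(x)\,dx=0\text{ for all }|\alpha|<L\}$. MDFP: a pair $(\chi^0,\chi^1)\in\mathcal{D}\times\mathcal{D}$ has the moment-wise decomposition factorization property if for some compact $K\subset\mathbb{R}^d$ (independent of $L$) there exist non-trivial functions $(\varphi^\ell_L,\psi^\ell_L)\in\mathcal{D}(K)\times\mathcal{D}_L(K)$, $\ell\in\{0,1\}$, $L\in\mathbb{N}$, such that for every $L\in\mathbb{N}$: $$2^d\varphi^0_L(2\,\cdot\,)-\varphi^0_L=\Delta\psi^0_L,\qquad \int_{\mathbb{R}^d}\varphi^0_L(x)\,dx=1,$$ $$\varphi^0_L=\chi^0*\varphi^0_L+\chi^1*\varphi^1_L,\qquad \psi^0_L=\chi^0*\psi^0_L+\chi^1*\psi^1_L,$$ where $\Delta$ is the Laplace operator. *)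

(* Defs.v *)
From HB Require Import structures.
From mathcomp Require Import all_boot all_order all_algebra.
From mathcomp Require Import all_classical all_reals all_analysis.

Set Implicit Arguments.
Unset Strict Implicit.
Unset Printing Implicit Defensive.

Import Order.TTheory GRing.Theory Num.Theory.
Import numFieldNormedType.Exports.

Local Open Scope classical_set_scope.
Local Open Scope ring_scope.

Section LebesgueTupleStep.
Context {R : realType} (n : nat).
Local Notation mR := (measurableTypeR R).
Variable m : {sigma_finite_measure set (n.-tuple mR) -> \bar R}.

Definition tuple_cons (p : mR * n.-tuple mR) : n.+1.-tuple mR :=
  [the n.+1.-tuple mR of p.1 :: p.2].

Definition tuple_uncons (t : n.+1.-tuple mR) : mR * n.-tuple mR :=
  (tnth t ord0, [tuple of behead t]).

Lemma tuple_consK : cancel tuple_cons tuple_uncons.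
Proof. by move=> [x t]; congr pair; apply/val_inj. Qed.

Lemma tuple_unconsK : cancel tuple_uncons tuple_cons.
Proof. by move=> t; rewrite [RHS]tuple_eta; apply/val_inj. Qed.

Lemma measurable_tuple_cons : measurable_fun [set: mR * n.-tuple mR] tuple_cons.
Proof. exact: (measurable_cons measurable_fst measurable_snd). Qed.

Lemma measurable_tuple_uncons :
  measurable_fun [set: n.+1.-tuple mR] tuple_uncons.
Proof.
by apply: measurable_fun_pair; [exact: measurable_tnth|exact: measurable_behead].
Qed.

Definition lebesgue_tuple_step : set (n.+1.-tuple mR) -> \bar R :=
  pushforward (@lebesgue_measure R \x m)%E tuple_cons.

Let step0 : lebesgue_tuple_step set0 = 0%E.
Proof. by rewrite /lebesgue_tuple_step /pushforward preimage_set0 measure0. Qed.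

Let step_ge0 A : (0 <= lebesgue_tuple_step A)%E.
Proof. by rewrite /lebesgue_tuple_step /pushforward; exact: measure_ge0. Qed.

Let step_sigma_additive : semi_sigma_additive lebesgue_tuple_step.
Proof.
rewrite /lebesgue_tuple_step => F mF tF mUF.
rewrite /pushforward preimage_bigcup.
apply: measure_semi_sigma_additive.
- by move=> k; rewrite -[X in measurable X]setTI; exact: measurable_tuple_cons.
- apply/trivIsetP => /= i j _ _ ij; rewrite -preimage_setI.
  by move/trivIsetP : tF => /(_ _ _ _ _ ij) ->//; rewrite preimage_set0.
- by rewrite -preimage_bigcup -[X in measurable X]setTI;
     exact: measurable_tuple_cons.
Qed.

HB.instance Definition _ := isMeasure.Build _ _ _
  lebesgue_tuple_step step0 step_ge0 step_sigma_additive.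

Let step_sigma_finite : sigma_finite setT lebesgue_tuple_step.
Proof.
have /sigma_finiteP[F [TF ndF Foo]] := sigma_finiteT (@lebesgue_measure R).
have /sigma_finiteP[G [TG ndG Goo]] := sigma_finiteT m.
exists (fun k => tuple_uncons @^-1` (F k `*` G k)).
  rewrite -preimage_bigcup -[LHS](preimage_setT tuple_uncons).
  congr (_ @^-1` _); apply/seteqP; split => [[x y] _|]//.
  have [i _ Fix] : (\bigcup_i F i) x by rewrite -TF.
  have [j _ Gjy] : (\bigcup_i G i) y by rewrite -TG.
  exists (maxn i j) => //; split => /=.
    by move: Fix; apply/subsetPset/ndF/leq_maxl.
  by move: Gjy; apply/subsetPset/ndG/leq_maxr.
move=> k; have [mF Fk] := Foo k; have [mG Gk] := Goo k.
have mFG : measurable (F k `*` G k) by exact: measurableX.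
split; first by rewrite -[X in measurable X]setTI; exact: measurable_tuple_uncons.
rewrite /lebesgue_tuple_step /pushforward -comp_preimage.
have -> : tuple_uncons \o tuple_cons = id by apply/funext/tuple_consK.
by rewrite preimage_id product_measure1E// lte_mul_pinfty// ge0_fin_numE.
Qed.

HB.instance Definition _ := Measure_isSigmaFinite.Build _ _ _
  lebesgue_tuple_step step_sigma_finite.

End LebesgueTupleStep.

(* d-dimensional Lebesgue measure, carried by d-tuples because row vectors have
   no measurableType structure in the library *)
Fixpoint lebesgue_tuple (R : realType) (d : nat) :
    {sigma_finite_measure set (d.-tuple (measurableTypeR R)) -> \bar R} :=
  match d with
  | 0 => dirac [tuple]
  | d'.+1 => lebesgue_tuple_step (lebesgue_tuple R d')
  end.

Section TestFunctions.
Context {R : realType} {d : nat}.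
Implicit Types (f g : 'rV[R]_d -> R) (K : set 'rV[R]_d) (L : nat).

Definition integral_rV f : R :=
  (\int[lebesgue_tuple R d]_t f (\row_i tnth t i))%R.

Definition convolution f g : 'rV[R]_d -> R :=
  fun x => integral_rV (fun y => f (x - y) * g y).

Definition partial (i : 'I_d) f : 'rV[R]_d -> R :=
  fun x => 'D_(delta_mx ord0 i) f x.

Definition laplacian f : 'rV[R]_d -> R :=
  fun x => \sum_(i < d) partial i (partial i f) x.

(* partial derivatives of all orders, in any order of differentiation,
   exist and are continuous *)
Definition smooth f : Prop :=
  forall s : seq 'I_d,
    continuous (foldr partial f s) /\
    forall (i : 'I_d) (x : 'rV[R]_d),
      derivable (foldr partial f s) x (delta_mx ord0 i).

Definition supp f : set 'rV[R]_d := closure [set x | f x != 0].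

Definition test_fun : set ('rV[R]_d -> R) :=
  [set f | smooth f /\ compact (supp f)].

Definition test_fun_on K : set ('rV[R]_d -> R) :=
  [set f | smooth f /\ supp f `<=` K].

Definition monomial (a : 'I_d -> nat) (x : 'rV[R]_d) : R :=
  \prod_(i < d) x ord0 i ^+ a i.

Definition test_fun_moment L K : set ('rV[R]_d -> R) :=
  [set f | test_fun_on K f /\
    forall a : 'I_d -> nat, (\sum_(i < d) a i < L)%N ->
      integral_rV (fun x => monomial a x * f x) = 0].

(* "non-trivial" is read as: none of the four functions vanishes identically,
   for any L *)
Definition MDFP (chi0 chi1 : 'rV[R]_d -> R) : Prop :=
  exists K : set 'rV[R]_d, compact K /\
  exists phi0 phi1 psi0 psi1 : nat -> 'rV[R]_d -> R, forall L : nat,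
    [/\ test_fun_on K (phi0 L) /\ test_fun_on K (phi1 L),
        test_fun_moment L K (psi0 L) /\ test_fun_moment L K (psi1 L)
      & [/\ phi0 L <> cst 0, phi1 L <> cst 0,
            psi0 L <> cst 0 & psi1 L <> cst 0]] /\
    [/\ forall x, 2 ^+ d * phi0 L (2 *: x) - phi0 L x = laplacian (psi0 L) x,
        integral_rV (phi0 L) = 1,
        forall x, phi0 L x =
          convolution chi0 (phi0 L) x + convolution chi1 (phi1 L) x
      & forall x, psi0 L x =
          convolution chi0 (psi0 L) x + convolution chi1 (psi1 L) x].

End TestFunctions.

(* Main.v *)
Require Import Defs.
From mathcomp Require Import all_boot all_order all_algebra.
From mathcomp Require Import all_classical all_reals all_analysis.
From mathcomp Require Import measurable_realfun matrix_normedtype ring lra.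

(* Write [T f := 2^d f (2 .)] and [Lap] for the Laplacian.  Cutting off the
   fundamental solution of [Lap] near the origin gives a radial test function
   [phi] with integral 1 and a test function [psi] with [T phi - phi = Lap psi].
   Take [chi0 := 0] and [chi1 := phi]: it remains to find [phi0] and [psi0] that
   are both divisible by [phi] for the convolution.  Start with
   [phi1 := T^-1 phi], [rho := T phi], [psi1 := psi + 4 T^-1 psi]; then
     [T (phi * phi1) = phi * rho]  and  [rho - phi1 = Lap psi1],
   so [phi0 := phi * phi1] and [psi0 := phi * psi1] satisfy
   [T phi0 - phi0 = Lap psi0].  For [S] a constant coefficient operator,
   homogeneous of order [k], both relations survive the replacement of
     [phi1] by [phi1 + Lap S phi1],  [rho] by [rho + 2^-(k+2) Lap S rho],
     [psi1] by [psi1 + S (2^-(k+2) rho - phi1)],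
   which enlarges no support.  It leaves the moments of [psi1] of order less
   than [k] unchanged, and [S] can be chosen to cancel those of order [k].
   Vanishing moments of [psi1] pass to [phi * psi1] by Fubini. *)

Set Implicit Arguments.
Unset Strict Implicit.
Unset Printing Implicit Defensive.
Import Order.TTheory GRing.Theory Num.Theory.
Import numFieldNormedType.Exports.
Local Open Scope classical_set_scope.
Local Open Scope ring_scope.

(** * Integration on row vectors *)

Section Tuples.
Context {R : realType}.
Local Notation mR := (measurableTypeR R).

(** The compact set must serve every order [L], so moments may only be cancelled by operations that
    keep supports; differential operators are of that kind. Another obstacle is that the dilation
    also moves the factor [phi]: applied to [phi * phi1] it gives [T phi * T phi1]. The choice
    [phi1 = T^-1 phi] swaps the factors, [T (phi * T^-1 phi) = T phi * phi], so [phi] divides both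
    terms of the difference. The formula for [psi1] is a telescoping sum, [T phi - T^-1 phi = Lap
    psi + T^-1 (Lap psi)], and its 4 comes from moving [T^-1] past [Lap]. Likewise
    [T Lap S = 2^-(k+2) Lap S T] dictates the three replacements. They can cancel a moment because
    [rho] and [phi1] both have integral 1: for [S = c D^a] the moment of index [a] changes by [c]
    times a nonzero multiple of [2^-(k+2) - 1]. For the base pair, the cut-off is made in the
    derivative of the potential with respect to [|x|^2]; this is a power in every dimension, so the
    logarithm at [d = 2] needs no separate treatment. *)

Lemma rV_norm_le n (x : 'rV[R]_n) (M : R) : 0 <= M ->
  (`|x| <= M) <-> (forall i, `|x ord0 i| <= M).
Proof.
move=> M0; rewrite [`|x|]mx_normrE; split.
  by move=> /bigmax_leP[_ h] i; have := h (ord0, i) isT.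
move=> h; apply/bigmax_leP; split => //= -[i j] _ /=.
by rewrite (ord1 i).
Qed.

Lemma rV_norm_lt n (x : 'rV[R]_n) (M : R) : 0 < M ->
  (`|x| < M) <-> (forall i, `|x ord0 i| < M).
Proof.
move=> M0; rewrite [`|x|]mx_normrE; split.
  by move=> /bigmax_ltP[_ h] i; have := h (ord0, i) isT.
move=> h; apply/bigmax_ltP; split => //= -[i j] _ /=.
by rewrite (ord1 i).
Qed.

Definition rV_of_tuple n (t : n.-tuple mR) : 'rV[R]_n := \row_i tnth t i.

Lemma measurable_tuple_ball n (q : 'rV[R]_n) (e : R) :
  measurable [set t : n.-tuple mR | forall i, `|q ord0 i - tnth t i| < e].
Proof.
rewrite [X in measurable X](_ : _ = \bigcap_(i : 'I_n)
   [set t : n.-tuple mR | `|q ord0 i - tnth t i| < e]).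
  apply: fin_bigcap_measurable => // i _.
  have -> : [set t : n.-tuple mR | `|q ord0 i - tnth t i| < e] =
     (fun t => tnth t i) @^-1` [set y : R | `|q ord0 i - y| < e] by [].
  rewrite -[X in measurable X]setTI; apply: measurable_tnth => //.
  by have := measurable_ball (q ord0 i) e; rewrite -ball_normE.
by apply/seteqP; split => t /= h i; [move=> _|]; apply: h.
Qed.

(** Tuples carry the product sigma-algebra, so the open set is exhausted by countably many cubes
    with rational centres and half-sides [1/(m+1)]. *)
Lemma measurable_rV_open n (U : set 'rV[R]_n) : open U ->
  measurable (@rV_of_tuple n @^-1` U).
Proof.
move=> oU.
pose B (p : 'rV[rat]_n * nat) : set 'rV[R]_n :=
  [set y | forall i, `|ratr (p.1 ord0 i) - y ord0 i| < p.2.+1%:R^-1].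
pose D := [set p | B p `<=` U].
rewrite [X in measurable X](_ : _ =
   \bigcup_(p in D) (@rV_of_tuple n @^-1` B p)).
  rewrite bigcup_mkcond; apply: countable_bigcupT_measurable => // p.
  case: ifPn => // _.
  rewrite [X in measurable X](_ : _ = [set t : n.-tuple mR |
     forall i, `|(\row_i ratr (p.1 ord0 i) : 'rV[R]_n) ord0 i - tnth t i|
        < p.2.+1%:R^-1]); last first.
    by apply/seteqP; split => t /= h i; have := h i; rewrite !mxE.
  exact: measurable_tuple_ball.
apply/seteqP; split => [t /= Ut|t /= [p Dp]]; last by move/Dp.
move: oU; rewrite openE => /(_ _ Ut); rewrite /interior => /nbhs_ballP[e /= e0 eU].
(* The factor 2 is for the triangle inequality: the cube around the rational centre contains [t],
   and each of its points is then within [2/(N+1)] of [t]. *)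
have [N Ne] : exists N : nat, 2 * N.+1%:R^-1 < e.
  have [N _ /(_ N (leqnn _)) /= h] := near_infty_natSinv_lt (PosNum (divr_gt0 e0 (ltr0Sn R 1))).
  by exists N; rewrite mulrC -ltr_pdivlMr.
have N0 : 0 < N.+1%:R^-1 :> R by [].
have /choice[q qP] (i : 'I_n) : exists q : rat, `|ratr q - tnth t i| < N.+1%:R^-1.
  have /rat_in_itvoo[q] : tnth t i - N.+1%:R^-1 < tnth t i + N.+1%:R^-1 :> R.
    by rewrite ltrD2l; apply: lt_trans N0; rewrite oppr_lt0.
  by rewrite in_itv/= => qP; exists q; rewrite ltr_distl.
exists (\row_i q i, N); last by move=> i; rewrite /= !mxE.
move=> y /= By; apply: eU; rewrite -ball_normE /ball_/=.
apply/rV_norm_lt => // i; rewrite !mxE.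
have := By i; rewrite !mxE => h1; have := qP i => h2.
rewrite (le_lt_trans _ Ne)// (_ : _ - _ = (tnth t i - ratr (q i)) + (ratr (q i) - y ord0 i)); last by ring.
rewrite (le_trans (ler_normD _ _))// mulr2n mulrDl mul1r lerD//; last exact: ltW.
by rewrite distrC ltW.
Qed.

Lemma measurable_rV_continuous n (f : 'rV[R]_n -> R) : continuous f ->
  measurable_fun setT (f \o @rV_of_tuple n).
Proof.
move=> /continuousP cf.
apply: (measurability _ (RGenOpens.measurableE R)) => _ [_ [a [b ->] <-]].
rewrite setTI comp_preimage; apply: measurable_rV_open.
by apply: cf; exact: interval_open.
Qed.
End Tuples.

Section Meas.
Context {R : realType}.
Local Notation mR := (measurableTypeR R).

Lemma lebesgue_tupleS n (A : set (n.+1.-tuple mR)) :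
  lebesgue_tuple R n.+1 A =
  (@lebesgue_measure R \x lebesgue_tuple R n)%E (@tuple_cons R n @^-1` A).
Proof. by []. Qed.

(** Integrability below comes from domination by a multiple of the indicator of a cube, hence the
    need for this volume. For [n = 0] both sides are 1, the mass of the Dirac measure. *)
Lemma lebesgue_tuple_ball n (q : 'rV[R]_n) (e : R) : 0 < e ->
  lebesgue_tuple R n [set t | forall i, `|q ord0 i - tnth t i| < e]
  = ((2 * e) ^+ n)%:E.
Proof.
move=> e0; elim: n q => [|n IH] q.
  by rewrite expr0 /= diracE mem_set//= => -[].
rewrite lebesgue_tupleS.
rewrite [X in (_ \x _)%E X](_ : _ = (ball (q ord0 ord0) e) `*`
   [set t : n.-tuple mR | forall i, `|(\row_j q ord0 (lift ord0 j)) ord0 i - tnth t i| < e]).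
  rewrite product_measure1E//.
  - transitivity ((2 * e)%:E * ((2 * e) ^+ n)%:E)%E; last by rewrite -EFinM exprS.
    by congr (_ * _)%E; [rewrite mulr_natl; exact: (lebesgue_measure_ball _ (ltW e0))|exact: IH].
  - exact: measurable_ball.
  - exact: measurable_tuple_ball.
apply/seteqP; split => -[x t] /=; rewrite -ball_normE /ball_/=.
  move=> h; split => [|i]; first by have := h ord0.
  by have := h (lift ord0 i); rewrite mxE (tnthS x).
move=> [h0 h] i; case: (unliftP ord0 i) => [j|] ->//.
by have := h j; rewrite mxE (tnthS x).
Qed.
End Meas.

(** * Affine substitutions and Tonelli *)

Section Meas.
Context {R : realType}.
Local Notation mR := (measurableTypeR R).
Local Notation leb := (@lebesgue_measure R).

Lemma measurable_affine (a c : R) : measurable_fun setT (fun x : mR => (a + c * x : mR)).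
Proof. 
apply: measurable_funD; first exact: measurable_cst.
exact: measurable_funM.
Qed.

(** Lebesgue measure is determined by its values on the intervals []x, y]], and the pushforward
    multiplied by [|c|] has the same values there. *)
Lemma lebesgue_measure_affine (a c : R) (A : set mR) : c != 0 -> measurable A ->
  pushforward leb (fun x : mR => (a + c * x : mR)) A = (`|c|^-1%:E * leb A)%E.
Proof.
move=> c0 mA.
have ca0 : 0 < `|c| by rewrite normr_gt0.
pose phi := fun x : mR => (a + c * x : mR).
have mphi : measurable_fun setT phi by exact: measurable_affine.
pose nu : {measure set mR -> \bar R} := mscale (NngNum (ltW ca0))
  (measure_function_pushforward__canonical__measure_function_Measure leb mphi).
suff -> : leb A = nu A.
  by rewrite /nu/= /mscale/= muleA -EFinM mulVf ?mul1e ?gt_eqF.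
apply: lebesgue_measure_unique => // _ [[x y]] _ <-.
rewrite /nu/= /mscale/= /pushforward/=.
have [cp|cn|/eqP] := ltgtP 0 c; last by rewrite eq_sym (negbTE c0).
- rewrite (_ : phi @^-1` _ = `](x - a) / c, (y - a) / c]%classic).
    rewrite !lebesgue_measure_itv/= !lte_fin ltr_pdivlMr// mulfVK// ltrD2r.
    case: ifPn => _; last by rewrite mule0.
    rewrite -!EFinD -EFinM; congr EFin; rewrite gtr0_norm//.
    by field.
  apply/seteqP; split => z /=; rewrite !in_itv/= ltr_pdivrMr// ler_pdivlMr// /phi (mulrC z) ltrBlDl lerBrDl//.
(* A negative [c] reverses the interval, so the preimage is closed on the left and open on the
   right. *)
- rewrite (_ : phi @^-1` _ = `[(y - a) / c, (x - a) / c[%classic).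
    rewrite !lebesgue_measure_itv/= !lte_fin ltr_ndivlMr// mulfVK// ltrD2r.
    case: ifPn => _; last by rewrite mule0.
    rewrite -!EFinD -EFinM; congr EFin; rewrite ltr0_norm//.
    by field.
  apply/seteqP; split => z /=; rewrite !in_itv/= ltr_ndivlMr// ler_ndivrMr// /phi (mulrC z) ltrBlDl lerBrDl andbC//.
Qed.

Lemma ge0_integral_affine (a c : R) (g : mR -> \bar R) : c != 0 ->
  measurable_fun setT g -> (forall x, 0 <= g x)%E ->
  (\int[leb]_x g (a + c * x)%R = `|c|^-1%:E * \int[leb]_x g x)%E.
Proof.
move=> c0 mg g0.
have ca0 : 0 <= `|c|^-1 by rewrite invr_ge0.
pose phi := fun x : mR => (a + c * x : mR).
have mphi : measurable_fun setT phi by exact: measurable_affine.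
have := @ge0_integral_pushforward _ _ mR mR R phi mphi leb setT g measurableT mg (fun x _ => g0 x).
rewrite preimage_setT => <-.
pose r := NngNum ca0.
rewrite (_ : `|c|^-1 = r%:num)// -ge0_integral_mscale//.
by apply: eq_measure_integral => A mA _; exact: lebesgue_measure_affine.
Qed.

Lemma ge0_integral_tupleS n (G : n.+1.-tuple mR -> \bar R) :
  measurable_fun setT G -> (forall t, 0 <= G t)%E ->
  (\int[lebesgue_tuple R n.+1]_t G t =
   \int[leb]_x \int[lebesgue_tuple R n]_t G (tuple_cons (x, t)))%E.
Proof.
move=> mG G0.
have := @ge0_integral_pushforward _ _ _ _ R _ (@measurable_tuple_cons R n)
  (leb \x lebesgue_tuple R n)%E setT G measurableT mG (fun x _ => G0 x).
rewrite preimage_setT => e; rewrite [LHS]e.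
rewrite (fubini_tonelli1 (G \o @tuple_cons R n))//=.
by apply: measurableT_comp => //; exact: measurable_tuple_cons.
Qed.

Definition tuple_affine n (a : 'rV[R]_n) (c : R) (t : n.-tuple mR) : n.-tuple mR :=
  [tuple (a ord0 i + c * tnth t i : mR) | i < n].

Lemma measurable_tuple_affine n (a : 'rV[R]_n) (c : R) :
  measurable_fun setT (tuple_affine a c).
Proof.
apply/measurable_fun_tnthP => i.
rewrite (_ : _ \o _ = (fun x : mR => a ord0 i + c * x) \o (fun t : n.-tuple mR => tnth t i)).
  apply: measurableT_comp; [exact: measurable_affine|exact: measurable_tnth].
by apply/funext => t; rewrite /= tnth_mktuple.
Qed.

(** Coordinates are split off one at a time by Tonelli; each contributes a factor [|c|^-1]. *)
Lemma ge0_integral_tuple_affine n (a : 'rV[R]_n) (c : R) (G : n.-tuple mR -> \bar R) : c != 0 ->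
  measurable_fun setT G -> (forall t, 0 <= G t)%E ->
  (\int[lebesgue_tuple R n]_t G (tuple_affine a c t) =
    (`|c|^-1 ^+ n)%:E * \int[lebesgue_tuple R n]_t G t)%E.
Proof.
move=> c0; elim: n a G => [|n IH] a G mG G0.
  rewrite expr0 mul1e; apply: eq_integral => t _; congr G.
  by apply/val_inj; rewrite (tuple0 t) (tuple0 (tuple_affine _ _ _)).
have mGa : measurable_fun setT (G \o tuple_affine a c).
  by apply: measurableT_comp => //; exact: measurable_tuple_affine.
rewrite (ge0_integral_tupleS (G := G \o tuple_affine a c))//.
rewrite (ge0_integral_tupleS mG)//.
have mGx x : measurable_fun setT (fun t : n.-tuple mR => G (tuple_cons (x, t))).
  apply: measurableT_comp => //.
  by apply: (measurableT_comp (@measurable_tuple_cons R n)); exact: measurable_pair1.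
under eq_integral => x _.
  under eq_integral => t _.
    rewrite (_ : (_ \o _) _ = G (tuple_cons (a ord0 ord0 + c * x, tuple_affine (\row_i a ord0 (lift ord0 i)) c t))); last first.
      rewrite /=; congr G; apply/eq_from_tnth => i.
      rewrite tnth_mktuple; case: (unliftP ord0 i) => [j|] ->//.
      by rewrite !tnthS tnth_mktuple mxE.
    over.
  rewrite (IH _ (fun t => G (tuple_cons (a ord0 ord0 + c * x, t))))//.
  over.
have mF : measurable_fun setT (fun x : mR => \int[lebesgue_tuple R n]_t G (tuple_cons (x, t)))%E.
  apply: (measurable_fun_fubini_tonelli_F (G \o @tuple_cons R n)) => //=.
  by apply: measurableT_comp => //; exact: measurable_tuple_cons.
have c1 : 0 <= `|c|^-1 by rewrite invr_ge0.
rewrite (@ge0_integral_affine (a ord0 ord0) c (fun x => (`|c|^-1 ^+ n)%:E * \int[lebesgue_tuple R n]_t G (tuple_cons (x, t)))%E)//.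
- rewrite ge0_integralZl//.
  + by rewrite muleA -EFinM exprS.
  + by move=> x _; exact: integral_ge0.
- exact: (measurable_funeM (`|c|^-1 ^+ n)%:E mF).
- move=> x; apply: mule_ge0; first by rewrite lee_fin exprn_ge0.
  exact: integral_ge0.
- by move=> t; exact: G0.
Qed.

End Meas.

(** * Integrals of compactly supported functions *)

Section Integral.
Context {R : realType} {n : nat}.
Local Notation mR := (measurableTypeR R).
Local Notation mu := (lebesgue_tuple R n).
Implicit Types f g : 'rV[R]_n -> R.

(** Supports are tracked by one number, the half-side of a cube, the norm being the maximum norm.
    Such bounds add under convolution and scale under dilation; [supp_le] returns to [supp]. *)
Definition csupp (M : R) f := forall x, M < `|x| -> f x = 0.

Definition integrable_rV f := mu.-integrable setT (EFin \o (f \o @rV_of_tuple R n)).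

Lemma integral_rVE f : integral_rV f = (\int[mu]_t (f (rV_of_tuple t)))%R.
Proof. by []. Qed.

(** The subtraction from [0] makes this literally an instance of the cube measured in
    [lebesgue_tuple_ball]. *)
Definition tbox (M : R) := [set t : n.-tuple mR | forall i, `|(0 : 'rV[R]_n) ord0 i - tnth t i| < M].

Lemma tboxP M (t : n.-tuple mR) : 0 < M -> tbox M t <-> `|rV_of_tuple t| < M.
Proof.
move=> M0; split => [h|/(rV_norm_lt _ M0) h].
  by apply/rV_norm_lt => // i; rewrite mxE; have := h i; rewrite mxE sub0r normrN.
by move=> i; rewrite mxE sub0r normrN; have := h i; rewrite mxE.
Qed.

Lemma measurable_tbox M : measurable (tbox M).
Proof. exact: measurable_tuple_ball. Qed.

Lemma integrable_indic_tuple_ball (q : 'rV[R]_n) (c e : R) : 0 < e ->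
  mu.-integrable setT (EFin \o (fun t => c *
    \1_[set t : n.-tuple mR | forall i, `|q ord0 i - tnth t i| < e] t)).
Proof.
move=> e0; set B := [set t | _].
have mB : measurable B by exact: measurable_tuple_ball.
have h : mu.-integrable setT (EFin \o (\1_B : _ -> R)).
  have mi : measurable_fun setT (\1_B : _ -> R) by apply: measurable_indic.
  apply/integrableP; split; first exact/measurable_EFinP.
  rewrite (eq_integral (fun t => (\1_B t)%:E)); last first.
    by move=> t _; rewrite /= ger0_norm.
  rewrite integral_indic// setIT.
  by rewrite [X in (X < _)%E](lebesgue_tuple_ball q e0) ltry.
have := integrableZl measurableT c h.
by apply: eq_integrable => // t _ /=; rewrite EFinM.
Qed.

Lemma integrable_tbox (c M : R) : 0 < M ->
  mu.-integrable setT (EFin \o (fun t => c * \1_(tbox M) t)).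
Proof. exact: integrable_indic_tuple_ball. Qed.

Lemma integrable_dominated (g : n.-tuple mR -> R) C M : 0 < M ->
  measurable_fun setT g -> (forall t, `|g t| <= C * \1_(tbox M) t) ->
  mu.-integrable setT (EFin \o g).
Proof.
move=> M0 mg gC; apply: (le_integrable measurableT _ _ (integrable_tbox C M0)).
  exact/measurable_EFinP.
by move=> t _ /=; rewrite lee_fin (le_trans (gC t))// ler_norm.
Qed.

Lemma csuppW M N f : M <= N -> csupp M f -> csupp N f.
Proof. by move=> MN h x Nx; apply: h; exact: le_lt_trans Nx. Qed.

Lemma csupp_bounded M f : continuous f -> csupp M f -> exists2 C, 0 <= C & forall x, `|f x| <= C.
Proof.
move=> cf sf; pose A := [set x : 'rV[R]_n | `|x| <= `|M|].
have cA : compact A.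
  apply: bounded_closed_compact.
    by exists `|M|; split => // y My x /= /le_trans; apply; exact: ltW.
  rewrite (_ : A = (fun x => `|x|) @^-1` [set y | y <= `|M|])//.
  by apply: closed_comp => [x _|]; [exact: norm_continuous|exact: closed_le].
have A0 : A !=set0 by exists 0; rewrite /A/= normr0.
have cnf : continuous (fun x => `|f x|).
  by move=> x; apply: continuous_comp; [exact: cf|exact: norm_continuous].
have [c _ hc] := EVT_max_rV A0 cA (continuous_subspaceT cnf).
exists `|f c| => // x; have [xM|Mx] := leP `|x| `|M|.
  by apply: hc; rewrite inE.
by rewrite sf ?normr0// (le_lt_trans (ler_norm M)).
Qed.

Lemma integrable_rV_csupp M f : continuous f -> csupp M f -> integrable_rV f.
Proof.
move=> cf sf; have [C C0 fC] := csupp_bounded cf sf.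
(* The absolute value covers a negative [M]; the 1 is added because [tbox] is an open cube. *)
have M1 : 0 < `|M| + 1 by rewrite ltr_wpDl.
apply: (@integrable_dominated _ C (`|M| + 1)) => //.
  exact: measurable_rV_continuous.
move=> t; rewrite indicE; have [h|/negP h] := boolP (t \in _).
  by rewrite mulr1; exact: fC.
rewrite /= sf ?normr0 ?mulr0// (le_lt_trans (ler_norm M))//.
rewrite (lt_le_trans (_ : _ < `|M| + 1)) ?ltrDl// leNgt.
by apply/negP => /(tboxP _ M1) h'; apply: h; rewrite inE.
Qed.

Lemma integral_rVD f g : integrable_rV f -> integrable_rV g ->
  integral_rV (fun x => f x + g x) = integral_rV f + integral_rV g.
Proof. by move=> h1 h2; rewrite !integral_rVE RintegralD. Qed.

Lemma integral_rVB f g : integrable_rV f -> integrable_rV g ->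
  integral_rV (fun x => f x - g x) = integral_rV f - integral_rV g.
Proof. by move=> h1 h2; rewrite !integral_rVE RintegralB. Qed.

Lemma integral_rVZ c f : integrable_rV f ->
  integral_rV (fun x => c * f x) = c * integral_rV f.
Proof. by move=> h; rewrite !integral_rVE RintegralZl. Qed.

Lemma integrable_rVD f g : integrable_rV f -> integrable_rV g -> integrable_rV (fun x => f x + g x).
Proof.
move=> h1 h2; have := integrableD measurableT h1 h2.
by apply: eq_integrable.
Qed.

Lemma integrable_rVZ c f : integrable_rV f -> integrable_rV (fun x => c * f x).
Proof.
move=> h1; have := integrableZl measurableT c h1.
by apply: eq_integrable => // x _ /=; rewrite EFinM.
Qed.

Lemma rV_of_tuple_affine a c (t : n.-tuple mR) :
  rV_of_tuple (tuple_affine a c t) = a + c *: rV_of_tuple t.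
Proof. by apply/rowP => i; rewrite !mxE tnth_mktuple. Qed.

Lemma integral_rV_affine (a : 'rV[R]_n) c f : c != 0 -> integrable_rV f ->
  integral_rV (fun x => f (a + c *: x)) = `|c|^-1 ^+ n * integral_rV f.
Proof.
move=> c0 intf; rewrite !integral_rVE /Rintegral.
set G := EFin \o (f \o @rV_of_tuple R n).
have mG : measurable_fun setT G by exact: measurable_int intf.
have iG : (\int[mu]_x G x)%E \is a fin_num by exact: integrable_fin_num.
rewrite (_ : (\int[mu]_x (f _)%:E)%E = (\int[mu]_t (G (tuple_affine a c t)))%E); last first.
  by apply: eq_integral => t _; rewrite /G/= rV_of_tuple_affine.
rewrite -[X in _ = X * _]/(fine (`|c|^-1 ^+ n)%:E) -fineM//; congr fine.
rewrite [LHS]integralE [X in (_ = _ * X)%E]integralE.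
(* The substitution is known for nonnegative integrands, so it is applied to the positive and the
   negative part. *)
have ep := ge0_integral_tuple_affine a c0 (measurable_funepos mG) (fun=> funepos_ge0 _ _).
have en := ge0_integral_tuple_affine a c0 (measurable_funeneg mG) (fun=> funeneg_ge0 _ _).
transitivity ((`|c|^-1 ^+ n)%:E * \int[mu]_t (G^\+ t) - (`|c|^-1 ^+ n)%:E * \int[mu]_t (G^\- t))%E.
  congr (_ - _)%E; [rewrite -[RHS]ep|rewrite -[RHS]en].
    by apply: eq_integral => t _; rewrite !unlock.
  by apply: eq_integral => t _; rewrite !unlock.
(* Integrability makes this difference well defined, which allows the constant to be factored out in
   the extended reals. *)
have iad : (\int[mu]_t (G^\+ t) +? - \int[mu]_t (G^\- t))%E.
  exact: (integrable_add_def measurableT intf).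
exact: (esym (muleBr _ iad)).
Qed.

End Integral.

(** * Smooth functions and convolution *)

Section DeriveLambda.
Context {R : realType} {V : normedModType R}.
Implicit Types (f g : V -> R) (x v : V) (df dg c : R).

Lemma is_derive_add f g x v df dg : is_derive x v f df -> is_derive x v g dg ->
  is_derive x v (fun y => f y + g y) (df + dg).
Proof. by move=> h1 h2; exact: is_deriveD. Qed.

Lemma is_derive_mul f g x v df dg : is_derive x v f df -> is_derive x v g dg ->
  is_derive x v (fun y => f y * g y) (f x * dg + g x * df).
Proof. by move=> h1 h2; exact: is_deriveM. Qed.

Lemma is_derive_scale c f x v df : is_derive x v f df ->
  is_derive x v (fun y => c * f y) (c * df).
Proof. by move=> h1; exact: is_deriveZ. Qed.
End DeriveLambda.

Section Smooth.
Context {R : realType} {d : nat}.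
Implicit Types (f g : 'rV[R]_d -> R) (i : 'I_d) (s : seq 'I_d) (x : 'rV[R]_d).
Local Notation e_ i := (delta_mx ord0 i : 'rV[R]_d).

(** Replaces inductions over lists of directions: a smoothness proof only has to exhibit a suitable
    class of functions stable under partial derivatives. *)
Lemma smooth_coind (P : ('rV[R]_d -> R) -> Prop) :
  (forall f, P f -> continuous f /\
     forall i, (forall x, derivable f x (e_ i)) /\ P (partial i f)) ->
  forall f, P f -> smooth f.
Proof.
move=> hP f Pf s.
have Ps : P (foldr (@partial R d) f s).
  by elim: s => //= i s /hP[_ /(_ i)[]].
by have [cf df] := hP _ Ps; split => // i x; exact: (df i).1.
Qed.

Lemma smooth_continuous f : smooth f -> continuous f.
Proof. by move=> /(_ [::])[]. Qed.

Lemma smooth_derivable f i x : smooth f -> derivable f x (e_ i).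
Proof. by move=> /(_ [::])[_]; exact. Qed.

Arguments smooth_derivable {f} i x _.

Lemma smooth_partial f i : smooth f -> smooth (partial i f).
Proof. by move=> sf s; have := sf (rcons s i); rewrite foldr_rcons. Qed.

Lemma smooth_foldr f s : smooth f -> smooth (foldr (@partial R d) f s).
Proof.
move=> sf; elim: s => [|i s IH]; first exact: sf.
exact: (smooth_partial i IH).
Qed.

Lemma is_derive_partial f i x : derivable f x (e_ i) ->
  is_derive x (e_ i) f (partial i f x).
Proof. by move=> h; apply: DeriveDef. Qed.

Lemma partialD f g i : smooth f -> smooth g ->
  partial i (fun x => f x + g x) = (fun x => partial i f x + partial i g x).
Proof.
move=> sf sg; apply/funext => x.
by have := deriveD (smooth_derivable i x sf) (smooth_derivable i x sg).
Qed.

Lemma partialZ c f i : smooth f ->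
  partial i (fun x => c * f x) = (fun x => c * partial i f x).
Proof.
move=> sf; apply/funext => x.
by have := deriveZ c (smooth_derivable i x sf).
Qed.

Lemma smoothD f g : smooth f -> smooth g -> smooth (fun x => f x + g x).
Proof.
move=> sf sg; apply: (@smooth_coind (fun h => exists f g,
  [/\ smooth f, smooth g & h = fun x => f x + g x])); last by exists f, g.
move=> _ [{sf sg}f [{}g [sf sg ->]]]; split.
  by move=> x; apply: (@continuousD _ _ _ f g); [exact: (smooth_continuous sf)|exact: (smooth_continuous sg)].
move=> i; split.
  by move=> x; apply: derivableD; exact: smooth_derivable.
rewrite (partialD i sf sg); exists (partial i f), (partial i g).
by split; [exact: (smooth_partial i sf)|exact: (smooth_partial i sg)|].
Qed.

Lemma smoothZ c f : smooth f -> smooth (fun x => c * f x).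
Proof.
move=> sf; apply: (@smooth_coind (fun h => exists f,
  smooth f /\ h = fun x => c * f x)); last by exists f.
move=> _ [{sf}f [sf ->]]; split.
  by move=> x; apply: (@continuousM _ _ (cst c) f); [exact: cst_continuous|exact: (smooth_continuous sf)].
move=> i; split.
  by move=> x; have := derivableZ (k := c) (smooth_derivable i x sf).
rewrite (partialZ c i sf); exists (partial i f).
by split; first exact: (smooth_partial i sf).
Qed.

(** Brings the one-variable chain rule within reach of directional derivatives. *)
Lemma is_derive_line f x v l :
  is_derive x v f l <-> is_derive (0 : R) 1 (fun h : R => f (h *: v + x)) l.
Proof.
have E : 'D_v f x = 'D_1 (fun h : R => f (h *: v + x)) (0 : R).
  rewrite /derive; set g1 := fun h => h^-1 *: _; set g2 := fun h => h^-1 *: _.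
  suff -> : g1 = g2 by [].
  by rewrite funeqE /g1 /g2 => h /=; rewrite addr0 scale0r add0r [_%:A]mulr1.
split => -[h1 h2].
  by apply: DeriveDef; [exact: ((derivable1P _ _ _).1 h1)|rewrite -E].
by apply: DeriveDef; [exact: ((derivable1P _ _ _).2 h1)|rewrite E].
Qed.

Lemma is_derive_dilation c f i x : derivable f (c *: x) (e_ i) ->
  is_derive x (e_ i) (fun x => f (c *: x)) (c * partial i f (c *: x)).
Proof.
move=> df.
have h : is_derive (0 : R) 1 ((fun h => f (h *: e_ i + c *: x)) \o (fun h => c * h))
    (partial i f (c *: x) * (c * 1)).
  apply: is_derive1_comp.
    by rewrite mulr0; apply/is_derive_line; exact: is_derive_partial.
rewrite mulr1 in h; apply/is_derive_line; rewrite mulrC.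
rewrite (_ : (fun h : R => _) =
  (fun h => f (h *: e_ i + c *: x)) \o (fun h => c * h))//.
by apply/funext => h' /=; rewrite scalerDr scalerA.
Qed.

Lemma partial_dilation c f i : smooth f ->
  partial i (fun x => f (c *: x)) = fun x => c * partial i f (c *: x).
Proof.
move=> sf; apply/funext => x.
by have [] := is_derive_dilation (smooth_derivable i (c *: x) sf).
Qed.

Lemma smooth_dilation c f : smooth f -> smooth (fun x => f (c *: x)).
Proof.
move=> sf; apply: (@smooth_coind (fun h => exists f a,
  smooth f /\ h = fun x => a * f (c *: x))); last first.
  by exists f, 1; split => //; apply/funext => x; rewrite mul1r.
move=> _ [{sf}f [a [sf ->]]]; split.
  move=> x; apply: (@continuousM _ _ (cst a) (fun x => f (c *: x))); first exact: cst_continuous.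
  apply: (@continuous_comp _ _ _ (fun x => c *: x) f); last exact: smooth_continuous.
  exact: scaler_continuous.
have dc i x : derivable (fun x => f (c *: x)) x (e_ i).
  by have [] := is_derive_dilation (smooth_derivable i (c *: x) sf).
move=> i; split.
  by move=> x; have := derivableZ (k := a) (dc i x).
exists (partial i f), (a * c); split; first exact: smooth_partial.
apply/funext => x; rewrite /partial.
have -> := deriveZ a (dc i x).
by rewrite -mulrA -[X in _ = _ * X](congr1 (fun g => g x) (partial_dilation c i sf)).
Qed.

Lemma csupp_partial M f i : csupp M f -> csupp M (partial i f).
Proof.
move=> sf x Mx; rewrite /partial (_ : f = fun x => f x)// .
rewrite -(derive_cst (0 : R) x (e_ i)); apply: near_eq_derive.
have : nbhs x [set y | M < `|y|].
  apply: open_nbhs_nbhs; split => //.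
  rewrite (_ : [set y | _] = (fun x : 'rV[R]_d => `|x|) @^-1` [set r | M < r])//.
  by apply: open_comp => [y _|]; [exact: norm_continuous|exact: open_gt].
by apply: filterS => y My; rewrite sf.
Qed.

Lemma csupp_foldr M f s : csupp M f -> csupp M (foldr (@partial R d) f s).
Proof. by move=> sf; elim: s => //= i s; exact: csupp_partial. Qed.

Lemma csuppD M f g : csupp M f -> csupp M g -> csupp M (fun x => f x + g x).
Proof. by move=> sf sg x Mx; rewrite sf// sg// addr0. Qed.

Lemma csuppZ M c f : csupp M f -> csupp M (fun x => c * f x).
Proof. by move=> sf x Mx; rewrite sf// mulr0. Qed.

End Smooth.
Arguments smooth_derivable {R d f} i x _.

(** * Convolution and its continuity *)

Section Convolution.
Context {R : realType} {d : nat}.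
Implicit Types (f g : 'rV[R]_d -> R) (i : 'I_d) (s : seq 'I_d) (x : 'rV[R]_d).
Local Notation mR := (measurableTypeR R).
Local Notation e_ i := (delta_mx ord0 i : 'rV[R]_d).

Lemma csupp_conv_integrand f g M x : csupp M f ->
  csupp (`|x| + M) (fun y => f (x - y) * g y).
Proof.
move=> sf y My; rewrite sf ?mul0r//.
have : `|y| <= `|x| + `|x - y|.
  by rewrite -{1}[y](subKr x) (le_trans (ler_normB _ _)).
by move/(lt_le_trans My); rewrite ltrD2l.
Qed.

Lemma continuous_subl f x : continuous f -> continuous (fun y : 'rV[R]_d => f (x - y)).
Proof.
move=> cf y; apply: (@continuous_comp _ _ _ (fun y : 'rV[R]_d => x - y) f); last exact: cf.
by apply: (@continuousB _ _ _ (cst x) id); [exact: cst_continuous|exact: cvg_id].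
Qed.

Lemma continuous_mul f g : continuous f -> continuous g ->
  continuous (fun y : 'rV[R]_d => f y * g y).
Proof. by move=> cf cg y; apply: (@continuousM _ _ f g); [exact: cf|exact: cg]. Qed.

Lemma continuous_add f g : continuous f -> continuous g ->
  continuous (fun y : 'rV[R]_d => f y + g y).
Proof. by move=> cf cg y; apply: (@continuousD _ _ _ f g); [exact: cf|exact: cg]. Qed.

Lemma continuous_scale c f : continuous f ->
  continuous (fun y : 'rV[R]_d => c * f y).
Proof. by move=> cf; apply: continuous_mul => // y; exact: cst_continuous. Qed.

Lemma continuous_sub f g : continuous f -> continuous g ->
  continuous (fun y : 'rV[R]_d => f y - g y).
Proof. by move=> cf cg y; apply: (@continuousB _ _ _ f g); [exact: cf|exact: cg]. Qed.

Lemma integrable_rV_conv f g M x : continuous f -> csupp M f -> continuous g ->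
  integrable_rV (fun y => f (x - y) * g y).
Proof.
move=> cf sf cg; apply: (@integrable_rV_csupp _ _ (`|x| + M)).
  by apply: continuous_mul => //; exact: continuous_subl.
exact: csupp_conv_integrand.
Qed.

Lemma integral_rV_bound f M C : continuous f -> csupp M f -> 0 <= M ->
  (forall x, `|x| <= M -> `|f x| <= C) -> `|integral_rV f| <= C * (2 * (M + 1)) ^+ d.
Proof.
move=> cf sf M0 fC; have fi := integrable_rV_csupp cf sf.
have M1 : 0 < M + 1 by rewrite ltr_wpDl.
have mb : measurable (tbox (n := d) (M + 1) : set (d.-tuple mR)).
  exact: measurable_tbox.
have C0 : 0 <= C by rewrite (le_trans _ (fC 0 _)) ?normr0.
rewrite integral_rVE (le_trans (le_normr_Rintegral _ _))//.
apply: (@le_trans _ _ (\int[lebesgue_tuple R d]_t (C * \1_(tbox (M + 1)) t))%R).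
  apply: le_Rintegral => //.
  - have := fi; move/integrable_norm; exact.
  - exact: integrable_tbox.
  - move=> t _; rewrite indicE; have [h|/negP h] := boolP (t \in _).
      rewrite mulr1; have [tM|tM] := leP `|rV_of_tuple t| M; first exact: fC.
      by rewrite sf ?normr0.
    rewrite mulr0 sf ?normr0//.
    rewrite (lt_le_trans (_ : _ < M + 1)) ?ltrDl// leNgt.
    by apply/negP => /(tboxP _ M1) h'; apply: h; rewrite inE.
rewrite RintegralZl//; last first.
  have := @integrable_tbox R d 1 _ M1.
  by apply: eq_integrable => // t _ /=; rewrite mul1r.
rewrite ler_wpM2l// /Rintegral integral_indic// setIT.
by rewrite [X in fine X](lebesgue_tuple_ball (0 : 'rV[R]_d) M1).
Qed.

Lemma compact_norm_le M : compact [set x : 'rV[R]_d | `|x| <= M].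
Proof.
apply: bounded_closed_compact.
  exists `|M|; split => // y My x /= xM; rewrite (le_trans xM)//.
  by rewrite (le_trans (ler_norm M))// ltW.
rewrite (_ : [set x | _] = (fun x : 'rV[R]_d => `|x|) @^-1` [set y | y <= M])//.
by apply: closed_comp => [x _|]; [exact: norm_continuous|exact: closed_le].
Qed.

Arguments compact_norm_le M : clear implicits.

Lemma bounded_on_ball g N : 0 <= N -> continuous g ->
  exists2 C, 0 <= C & forall y, `|y| <= N -> `|g y| <= C.
Proof.
move=> N0 cg.
have A0 : [set x : 'rV[R]_d | `|x| <= N] !=set0 by exists 0; rewrite /= normr0.
have cng : continuous (fun y => `|g y|).
  by move=> y; apply: continuous_comp; [exact: cg|exact: norm_continuous].
have [c _ hc] := EVT_max_rV A0 (compact_norm_le N) (continuous_subspaceT cng).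
by exists `|g c| => // y yN; apply: hc; rewrite inE.
Qed.

(** For [x] near [x0] all integrands live in one cube, and its compactness makes the continuity of
    [f] uniform in the integration variable. *)
Lemma convolution_continuous f g M : 0 <= M -> continuous f -> csupp M f ->
  continuous g -> continuous (convolution f g).
Proof.
move=> M0 cf sf cg.
suff H (x0 : 'rV[R]_d) : convolution f g x @[x --> x0] --> convolution f g x0 by move=> x0; exact: H.
apply/(@cvgrPdist_lt _ _ _ (nbhs x0) _) => e e0.
(* On the support [|x - y|] is at most [M], and the 1 lets [x] range over the unit ball around
   [x0]. *)
pose N := `|x0| + 1 + M.
have N0 : 0 <= N by rewrite !addr_ge0.
have [C C0 gC] := bounded_on_ball N0 cg.
pose V := (2 * (N + 1)) ^+ d.
have V0 : 0 <= V by rewrite exprn_ge0// mulr_ge0// addr_ge0.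
(* The difference of the integrals will be at most [r * C * V]; the 1 keeps the denominator positive
   and the final inequality strict. *)
pose r := e / (C * V + 1).
have CV1 : 0 < C * V + 1 by rewrite ltr_wpDl// mulr_ge0.
have r0 : 0 < r by rewrite divr_gt0.
have /compact_near_coveringP cov := compact_norm_le N.
have near1 : \forall x \near x0, [set y | `|y| <= N] `<=` [set y | `|f (x0 - y) - f (x - y)| < r].
  apply: (cov _ (nbhs x0) (fun x y => `|f (x0 - y) - f (x - y)| < r)) => y _.
  have FF : Filter (nbhs (y : 'rV[R]_d, x0)) by exact: nbhs_filter.
  have cont : `|f (x0 - p.1) - f (p.2 - p.1)| @[p --> (y : 'rV[R]_d, x0)] --> `|f (x0 - y) - f (x0 - y)|.
    have cp1 : p.1 @[p --> (y : 'rV[R]_d, x0)] --> (y : 'rV[R]_d) by exact: cvg_fst.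
    have cp2 : p.2 @[p --> (y : 'rV[R]_d, x0)] --> x0 by exact: cvg_snd.
    have c1 := @continuous_cvg _ _ _ _ FF _ f _ (cf (x0 - y)) (@cvgB _ _ _ _ FF _ _ _ _ (@cvg_cst _ x0 _ _ FF) cp1).
    have c2 := @continuous_cvg _ _ _ _ FF _ f _ (cf (x0 - y)) (@cvgB _ _ _ _ FF _ _ _ _ cp2 cp1).
    have c3 : f (x0 - p.1) - f (p.2 - p.1) @[p --> (y : 'rV[R]_d, x0)] --> f (x0 - y) - f (x0 - y) := @cvgB _ _ _ _ FF _ _ _ _ c1 c2.
    exact: (@cvg_norm _ _ _ _ FF _ _ c3).
  have := @cvgr_lt _ _ _ FF _ _ cont r; rewrite /= subrr normr0 => /(_ r0) [[A B]/= [hA hB] hAB].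
  by exists (A, B) => // -[p q] /= [pA qB]; apply: (hAB (p, q)).
have near2 : \forall x \near x0, `|x - x0| < 1.
  by have := nbhsx_ballx x0 1 ltr01; apply: filterS => x; rewrite -ball_normE /= distrC.
near=> x.
have xx1 : `|x| <= `|x0| + 1.
  rewrite -[x](subrK x0) addrC (le_trans (ler_normD _ _))// lerD2l ltW//.
rewrite /convolution -integral_rVB; [|exact: (integrable_rV_conv _ cf sf cg)..].
rewrite (le_lt_trans (@integral_rV_bound _ N (r * C) _ _ N0 _))//.
- by apply: continuous_sub; apply: continuous_mul => //; exact: continuous_subl.
- have h1 := @csupp_conv_integrand f g M x0 sf.
  have h2 := @csupp_conv_integrand f g M x sf.
  move=> y Ny; rewrite h1 ?h2 ?subrr//.
    by rewrite (le_lt_trans _ Ny)// lerD2r.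
  by rewrite (le_lt_trans _ Ny)// lerD2r lerDl.
- move=> y yN; rewrite -mulrBl normrM ler_pM// ?gC//.
  apply: ltW; suff : [set y | `|f (x0 - y) - f (x - y)| < r] y by [].
  suff : [set y | `|y| <= N] `<=` [set y | `|f (x0 - y) - f (x - y)| < r] by apply.
  near: x; exact: near1.
- rewrite -/V -mulrA /r -mulrA -[ltRHS]mulr1 ltr_pM2l// mulrC.
  by rewrite ltr_pdivrMr// mul1r ltrDl.
Unshelve. all: by end_near. Qed.

End Convolution.

(** * Derivatives of convolutions *)

Section ConvDerivative.
Context {R : realType} {d : nat}.
Implicit Types (f g : 'rV[R]_d -> R) (i : 'I_d) (s : seq 'I_d) (x : 'rV[R]_d).
Local Notation mR := (measurableTypeR R).
Local Notation e_ i := (delta_mx ord0 i : 'rV[R]_d).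

Lemma is_derive_shift_line f g i x (y : 'rV[R]_d) (h : R) :
  (forall x, derivable f x (e_ i)) ->
  is_derive h 1 (fun h => f (h *: e_ i + x - y) * g y)
     (partial i f (h *: e_ i + x - y) * g y).
Proof.
move=> df.
set z := h *: e_ i + x - y.
have h1 := (is_derive_line _ _ _ _).1 (is_derive_partial (df z)).
have h2 : is_derive h (1 : R) (fun k : R => k - h) 1.
  by have := is_derive_add (is_derive_id h (1 : R)) (is_derive_cst (- h) h (1 : R)); rewrite addr0.
have h3 : is_derive h 1 ((fun k : R => f (k *: e_ i + z)) \o (fun k => k - h)) (partial i f z * 1).
  by apply: is_derive1_comp; rewrite subrr.
rewrite mulrC; under eq_fun do rewrite mulrC.
apply: is_derive_scale; rewrite mulr1 in h3.
rewrite (_ : (fun y0 => _) = (fun k : R => f (k *: e_ i + z)) \o (fun k => k - h))//.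
by apply/funext => k /=; rewrite scalerBl /z addrA addrA subrK.
Qed.

(** Differentiation under the integral sign along [h e_i + x]. Regularity is asked in direction [i]
    alone, because through [integral_rV_partial] this is later applied to a monomial times a test
    function. *)
Lemma is_derive_convolution f g M i x : 0 <= M -> continuous f -> csupp M f ->
  (forall x, derivable f x (e_ i)) -> continuous (partial i f) -> continuous g ->
  is_derive x (e_ i) (convolution f g) (convolution (partial i f) g x).
Proof.
move=> M0 cf sf df cdf cg.
have sdf : csupp M (partial i f) by exact: csupp_partial.
pose F (h : R) (t : d.-tuple mR) : R :=
  f (h *: e_ i + x - rV_of_tuple t) * g (rV_of_tuple t).
have dF (h : R) t : is_derive h (1 : R) (F ^~ t)
    (partial i f (h *: e_ i + x - rV_of_tuple t) * g (rV_of_tuple t)).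
  exact: is_derive_shift_line.
have [C1 C10 dfC] := csupp_bounded cdf sdf.
(* The parameter is confined to [|h| < 1] and the unit vector has norm at most 1, so the moved point
   has norm at most [|x| + 1]. *)
pose N := `|x| + 1 + M.
have N0 : 0 <= N by rewrite !addr_ge0.
have N1 : 0 < N + 1 by rewrite ltr_wpDl.
have [C2 C20 gC] := bounded_on_ball N0 cg.
pose G (t : d.-tuple mR) : R := C1 * C2 * \1_(tbox (N + 1)) t.
have intG : (lebesgue_tuple R d).-integrable setT (EFin \o G) by exact: integrable_tbox.
have G0 t : 0 <= G t by rewrite !mulr_ge0.
have intF h : `]-1, 1[%classic h -> (lebesgue_tuple R d).-integrable setT (EFin \o F h).
  by move=> _; exact: (integrable_rV_conv _ cf sf cg).
have derF h t : `]-1, 1[%classic h -> setT t -> derivable (F ^~ t) h 1.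
  by move=> _ _; have [] := dF h t.
have d1E h t : partial1of2 F h t = partial i f (h *: e_ i + x - rV_of_tuple t) * g (rV_of_tuple t).
  by rewrite partial1of2E; have [_ ->] := dF h t.
have Gub h t : `]-1, 1[%classic h -> setT t -> `|partial1of2 F h t| <= G t.
  move=> /=; rewrite in_itv/= => /andP[h1 h2] _; rewrite d1E /G.
  have hx : `|h *: e_ i + x| <= `|x| + 1.
    rewrite addrC (le_trans (ler_normD _ _))// lerD2l normrZ.
    rewrite (_ : `|h| * _ <= 1)// -[leRHS]mulr1 ler_pM//; first by rewrite ltW// ltr_norml h1.
    apply/rV_norm_le => // j; rewrite mxE eqxx/=.
    by case: eqP => _; rewrite ?normr1 ?normr0.
  rewrite indicE; have [h'|/negP h'] := boolP (t \in _).
    rewrite mulr1 normrM; have [tN|tN] := leP `|rV_of_tuple t| N.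
      by rewrite ler_pM// ?dfC ?gC.
    rewrite -normrM (csupp_conv_integrand g sdf) ?normr0 ?mulr_ge0//.
    by rewrite (le_lt_trans _ tN)// lerD2r.
  rewrite mulr0 (csupp_conv_integrand g sdf) ?normr0//.
  rewrite (le_lt_trans (_ : _ <= N)) ?lerD2r//.
  rewrite (lt_le_trans (_ : _ < N + 1)) ?ltrDl// leNgt.
  by apply/negP => /(tboxP _ N1) h''; apply: h'; rewrite inE.
have I0 : `]-1, 1[%classic (0 : R) by rewrite /= in_itv/= ltr01 ltrN10.
have H1 := @derivable_under_integral R _ _ (lebesgue_tuple R d) F setT measurableT 0 (-1) 1 I0 intF derF G G0 intG Gub.
have H2 := @differentiation_under_integral R _ _ (lebesgue_tuple R d) F setT measurableT 0 (-1) 1 I0 intF derF G G0 intG Gub.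
apply/is_derive_line.
apply: DeriveDef; first exact: H1.
rewrite -derive1E; rewrite [LHS]H2 /convolution integral_rVE.
apply: eq_Rintegral => t _.
by have := d1E 0 t; rewrite scale0r add0r.
Qed.

Lemma convolutionC f g M x : continuous f -> csupp M f -> continuous g ->
  convolution f g x = convolution g f x.
Proof.
move=> cf sf cg.
have := @integral_rV_affine R d x (-1) (fun y => f (x - y) * g y).
rewrite oppr_eq0 oner_eq0 => /(_ isT (integrable_rV_conv _ cf sf cg)).
rewrite normrN1 invr1 expr1n mul1r /convolution => <-.
congr integral_rV; apply/funext => y.
by rewrite scaleN1r opprB [x + _]addrC subrK mulrC.
Qed.

Lemma partial_convolution f g M i : 0 <= M -> smooth f -> csupp M f -> continuous g ->
  partial i (convolution f g) = convolution (partial i f) g.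
Proof.
move=> M0 sf cf cg; apply/funext => x.
have [] // := @is_derive_convolution f g M i x M0 _ cf _ _ cg.
- exact: smooth_continuous.
- by move=> y; exact: smooth_derivable.
- exact/smooth_continuous/smooth_partial.
Qed.

Lemma smooth_convolution f g M : 0 <= M -> smooth f -> csupp M f -> continuous g ->
  smooth (convolution f g).
Proof.
move=> M0 sf cf cg; apply: (@smooth_coind _ _ (fun h => exists f,
  [/\ smooth f, csupp M f & h = convolution f g])); last by exists f.
move=> _ [{sf cf}f [sf cf ->]]; split.
  exact: (convolution_continuous M0 (smooth_continuous sf) cf cg).
move=> i; split.
  move=> x; have [] // := @is_derive_convolution f g M i x M0 _ cf _ _ cg.
  - exact: smooth_continuous.
  - by move=> y; exact: smooth_derivable.
  - exact/smooth_continuous/smooth_partial.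
exists (partial i f); split; [exact: smooth_partial|exact: csupp_partial|].
exact: (partial_convolution _ M0).
Qed.

(** Commutativity makes [g] the factor that carries the derivative in [partial_convolution]. *)
Lemma convolution_partial f g M N i : 0 <= M -> 0 <= N ->
  smooth f -> csupp M f -> smooth g -> csupp N g ->
  convolution f (partial i g) = partial i (convolution f g).
Proof.
move=> M0 N0 sf cf sg cg.
have sgi := smooth_partial i sg.
have cgf : convolution f g = convolution g f.
  by apply/funext => x; apply: (convolutionC _ _ cf); exact: smooth_continuous.
rewrite cgf (partial_convolution i N0 sg cg (smooth_continuous sf)).
by apply/funext => x; apply: (convolutionC _ _ cf); exact: smooth_continuous.
Qed.

Lemma csupp_convolution f g M N : csupp M f -> csupp N g ->
  csupp (M + N) (convolution f g).
Proof.
move=> cf cg x Mx; rewrite /convolution (_ : (fun y => _) = fun=> 0).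
  by rewrite integral_rVE Rintegral_cst// mul0r.
apply/funext => y; have [Ny|yN] := ltP N `|y|; first by rewrite cg ?mulr0.
rewrite cf ?mul0r//.
have : `|x| <= `|x - y| + `|y| by rewrite -{1}[x](subrK y) ler_normD.
move=> /(lt_le_trans Mx) h; rewrite -(ltrD2r `|y|); apply: le_lt_trans h.
by rewrite lerD2l.
Qed.

Lemma convolutionDr f g h M : continuous f -> csupp M f -> continuous g -> continuous h ->
  convolution f (fun x => g x + h x) = fun x => convolution f g x + convolution f h x.
Proof.
move=> cf sf cg ch; apply/funext => x.
rewrite /convolution -integral_rVD; [|exact: (integrable_rV_conv _ cf sf)..].
by congr integral_rV; apply/funext => y; rewrite mulrDr.
Qed.

Lemma convolutionZr c f g M : continuous f -> csupp M f -> continuous g ->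
  convolution f (fun x => c * g x) = fun x => c * convolution f g x.
Proof.
move=> cf sf cg; apply/funext => x.
rewrite /convolution -integral_rVZ; last exact: (integrable_rV_conv _ cf sf).
by congr integral_rV; apply/funext => y; rewrite mulrCA.
Qed.

Lemma convolution1r f M x : continuous f -> csupp M f ->
  convolution f (fun=> 1) x = integral_rV f.
Proof.
move=> cf sf; have := @integral_rV_affine R d x (-1) f.
rewrite oppr_eq0 oner_eq0 => /(_ isT (integrable_rV_csupp cf sf)).
rewrite normrN1 invr1 expr1n mul1r => <-.
rewrite /convolution; congr integral_rV; apply/funext => y.
by rewrite scaleN1r mulr1.
Qed.

(* Differentiate the constant function [convolution f 1]. *)
Lemma integral_rV_partial f i M : 0 <= M -> continuous f -> csupp M f ->
  (forall x, derivable f x (e_ i)) -> continuous (partial i f) ->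
  integral_rV (partial i f) = 0.
Proof.
move=> M0 cf sf df cdf.
have c1 : continuous (fun _ : 'rV[R]_d => 1 : R) by move=> x; exact: cst_continuous.
rewrite -(convolution1r 0 cdf (csupp_partial i sf)).
have [_ <-] := @is_derive_convolution f (fun=> 1) M i 0 M0 cf sf df cdf c1.
rewrite (_ : convolution f _ = cst (integral_rV f)) ?derive_cst//.
by apply/funext => x; exact: convolution1r cf sf.
Qed.

End ConvDerivative.

(** * Fubini and finite sums *)

Section Fubini.
Context {R : realType} {d : nat}.
Implicit Types (f g : 'rV[R]_d -> R) (i : 'I_d) (x : 'rV[R]_d).
Local Notation mR := (measurableTypeR R).
Local Notation mu := (lebesgue_tuple R d).

Lemma Rintegral_tuple_Fubini (F : d.-tuple mR -> d.-tuple mR -> R) C M : 0 < M ->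
  measurable_fun setT (fun p : d.-tuple mR * d.-tuple mR => F p.1 p.2) ->
  (forall s t, `|F s t| <= C * (\1_(tbox M) s * \1_(tbox M) t)) ->
  (\int[mu]_s \int[mu]_t F s t)%R = (\int[mu]_t \int[mu]_s F s t)%R.
Proof.
move=> M0 mF FC.
pose Fe p := (F p.1 p.2)%:E.
have mFe : measurable_fun setT Fe by exact/measurable_EFinP.
have mb : measurable (tbox (n := d) M : set (d.-tuple mR)) by exact: measurable_tbox.
have mbb : measurable (tbox M `*` tbox M : set (d.-tuple mR * d.-tuple mR)).
  exact: measurableX.
have muM : mu (tbox M) = ((2 * M) ^+ d)%:E := lebesgue_tuple_ball (0 : 'rV[R]_d) M0.
have muMM : (mu \x mu)%E (tbox M `*` tbox M) = ((2 * M) ^+ d * (2 * M) ^+ d)%:E.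
  by rewrite product_measure1E// EFinM; congr (_ * _)%E; exact: muM.
(* The bound at the origin, which lies in the box, already forces the sign of [C]. *)
have C0 : 0 <= C.
  have M0' : tbox M [tuple (0 : mR) | _ < d].
    by move=> i; rewrite mxE tnth_mktuple subrr normr0.
  have := FC [tuple (0 : mR) | _ < d] [tuple (0 : mR) | _ < d].
  by rewrite !indicE mem_set// !mulr1; exact: le_trans.
have mi : measurable_fun setT (EFin \o (\1_(tbox M `*` tbox M : set (d.-tuple mR * d.-tuple mR)) : _ -> R)).
  by apply/measurable_EFinP; exact: measurable_indic.
have iF : (mu \x mu)%E.-integrable setT Fe.
  apply/integrableP; split => //.
  apply: (@le_lt_trans _ _ (\int[mu \x mu]_p (C%:E * (\1_(tbox M `*` tbox M) p)%:E))%E).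
    apply: ge0_le_integral => //.
    - exact: measurableT_comp.
    - exact: (measurable_funeM C%:E mi).
    - move=> [s t] _ /=; rewrite -EFinM lee_fin (le_trans (FC s t))//.
      by rewrite ler_wpM2l// !indicE in_setX -natrM mulnb.
  rewrite ge0_integralZl//.
  rewrite integral_indic// setIT.
  by rewrite [X in (_ * X < _)%E]muMM -EFinM ltry.
have int1 s : mu.-integrable setT (EFin \o F s).
  apply: (@integrable_dominated _ _ _ C M) => //.
    exact: (measurableT_comp mF (measurable_pair1 s)).
  move=> t; rewrite (le_trans (FC s t))// ler_wpM2l// ler_piMl//.
have int2 t : mu.-integrable setT (EFin \o (F ^~ t)).
  apply: (@integrable_dominated _ _ _ C M) => //.
    exact: (measurableT_comp mF (measurable_pair2 t)).
  move=> s; rewrite (le_trans (FC s t))// ler_wpM2l// ler_piMr//.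
have E1 s : ((fine (\int[mu]_t (F s t)%:E))%:E = \int[mu]_t (F s t)%:E)%E.
  exact: fineK (integrable_fin_num measurableT (int1 s)).
have E2 t : ((fine (\int[mu]_s (F s t)%:E))%:E = \int[mu]_s (F s t)%:E)%E.
  exact: fineK (integrable_fin_num measurableT (int2 t)).
have FF := Fubini iF.
rewrite /Rintegral; congr fine.
transitivity (\int[mu]_s \int[mu]_t (F s t)%:E)%E.
  by apply: eq_integral => s _; exact: E1.
transitivity (\int[mu]_t \int[mu]_s (F s t)%:E)%E; first exact: FF.
by apply: eq_integral => t _; rewrite -E2.
Qed.

(** The two claims are proved together, since additivity in the induction step needs the
    integrability of the tail. *)
Lemma integral_rV_sum (I : Type) (r : seq I) (P : pred I) (F : I -> 'rV[R]_d -> R) :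
  (forall j, integrable_rV (F j)) ->
  integrable_rV (fun x => \sum_(j <- r | P j) F j x) /\
  integral_rV (fun x => \sum_(j <- r | P j) F j x) = \sum_(j <- r | P j) integral_rV (F j).
Proof.
move=> iF; elim: r => [|j r [IH1 IH2]].
  have -> : (fun x => \sum_(j <- [::] | P j) F j x) = fun=> 0.
    by apply/funext => x; rewrite big_nil.
  rewrite big_nil; split; last by rewrite integral_rVE Rintegral_cst// mul0r.
  by have := @integrable0 _ _ _ mu setT; apply: eq_integrable.
rewrite big_cons.
have E : (fun x => \sum_(j <- j :: r | P j) F j x) =
   fun x => if P j then F j x + \sum_(j <- r | P j) F j x else \sum_(j <- r | P j) F j x.
  by apply/funext => x; rewrite big_cons.
rewrite E; case: ifP => // _; split; first exact: integrable_rVD.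
by rewrite integral_rVD// IH2.
Qed.

End Fubini.

(** * Moments *)

Section Moments.
Context {R : realType} {d : nat}.
Implicit Types (f g : 'rV[R]_d -> R) (i : 'I_d) (x : 'rV[R]_d) (a : 'I_d -> nat).
Local Notation mR := (measurableTypeR R).
Local Notation mu := (lebesgue_tuple R d).
Local Notation e_ i := (delta_mx ord0 i : 'rV[R]_d).

Definition moment f a : R := integral_rV (fun x => monomial a x * f x).

Lemma continuous_monomial a : continuous (monomial a : 'rV[R]_d -> R).
Proof.
rewrite /monomial; elim: (index_enum _) => [|j r IH].
  rewrite (_ : (fun x => _) = fun=> 1); first by move=> x; exact: cst_continuous.
  by apply/funext => x; rewrite big_nil.
rewrite (_ : (fun x => _) = fun x : 'rV[R]_d => x ord0 j ^+ a j * \prod_(i <- r) x ord0 i ^+ a i); last first.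
  by apply/funext => x; rewrite big_cons.
apply: continuous_mul => // x.
apply: (@continuous_comp _ _ _ (fun x : 'rV[R]_d => x ord0 j) (fun y => y ^+ a j)).
  exact: coord_continuous.
exact: exprn_continuous.
Qed.

Lemma integrable_rV_moment f a M : continuous f -> csupp M f -> integrable_rV (fun x => monomial a x * f x).
Proof.
move=> cf sf; apply: (@integrable_rV_csupp _ _ M).
  by apply: continuous_mul => //; exact: continuous_monomial.
by move=> x Mx; rewrite sf ?mulr0.
Qed.

Lemma moment0 f : moment f (fun=> 0%N) = integral_rV f.
Proof.
by congr integral_rV; apply/funext => x; rewrite /monomial big1 ?mul1r.
Qed.

Lemma momentD f g a M : continuous f -> csupp M f -> continuous g -> csupp M g ->
  moment (fun x => f x + g x) a = moment f a + moment g a.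
Proof.
move=> cf sf cg sg; rewrite -(integral_rVD (integrable_rV_moment a cf sf) (integrable_rV_moment a cg sg)).
by congr integral_rV; apply/funext => x; rewrite mulrDr.
Qed.

Lemma momentZ c f a M : continuous f -> csupp M f ->
  moment (fun x => c * f x) a = c * moment f a.
Proof.
move=> cf sf; rewrite -(integral_rVZ c (integrable_rV_moment a cf sf)).
by congr integral_rV; apply/funext => x; rewrite mulrCA.
Qed.

Lemma measurable_tuple_sub :
  measurable_fun setT (fun p : d.-tuple mR * d.-tuple mR =>
    [tuple (tnth p.1 i - tnth p.2 i : mR) | i < d]).
Proof.
apply/measurable_fun_tnthP => i.
rewrite (_ : _ \o _ = (fun p : d.-tuple mR * d.-tuple mR => tnth p.1 i - tnth p.2 i)).
  apply: measurable_funB.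
    apply: (measurableT_comp (measurable_tnth i)); exact: measurable_fst.
  apply: (measurableT_comp (measurable_tnth i)); exact: measurable_snd.
by apply/funext => t; rewrite /= tnth_mktuple.
Qed.

(** The exponents range over functions into ['I_N] in order to have a finite index type. The surplus
    terms, with some [r i > a i], carry a zero binomial coefficient, so the truncated [a i - r i]
    does no harm. *)
Lemma monomialD_sum a (N : nat) x y : (forall i, (a i < N)%N) ->
  monomial a (x + y) = \sum_(r : {ffun 'I_d -> 'I_N})
    (\prod_i 'C(a i, r i)%:R) * (monomial (fun i => a i - r i)%N x * monomial (fun i => r i) y).
Proof.
move=> aN; rewrite /monomial.
transitivity (\prod_(i < d) \sum_(j < N) ('C(a i, j)%:R * (x ord0 i ^+ (a i - j) * y ord0 i ^+ j))).
  apply: eq_bigr => i _; rewrite mxE exprDn.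
  rewrite (big_ord_widen N (fun j => x ord0 i ^+ (a i - j) * y ord0 i ^+ j *+ 'C(a i, j)))//.
  rewrite big_mkcond/=; apply: eq_bigr => j _; rewrite mulr_natl ltnS.
  by case: leqP => // h; rewrite bin_small.
rewrite bigA_distr_bigA; apply: eq_bigr => r _.
by rewrite !big_split.
Qed.

(** Write [x = (x - y) + y], expand the monomial and exchange the integrals. It serves twice: for
    the integral of a convolution ([a = 0], [K = 1]) and for the inheritance of vanishing
    moments. *)
Lemma moment_convolution f g M N a (K : nat) : 0 <= M -> 0 <= N ->
  continuous f -> csupp M f -> continuous g -> csupp N g -> (forall i, (a i < K)%N) ->
  moment (convolution f g) a = \sum_(r : {ffun 'I_d -> 'I_K})
    (\prod_i 'C(a i, r i)%:R) *
      (moment f (fun i => a i - r i)%N * moment g (fun i => r i)).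
Proof.
move=> M0 N0 cf sf cg sg aK.
pose F (s t : d.-tuple mR) : R := monomial a (rV_of_tuple s) *
  (f (rV_of_tuple s - rV_of_tuple t) * g (rV_of_tuple t)).
(* The supports give [|t| <= N] and [|s| <= M + N]; the 1 passes to an open cube. *)
pose P := M + N + 1.
have P0 : 0 < P by rewrite ltr_wpDl// addr_ge0.
have [Ca Ca0 aC] := bounded_on_ball (ltW P0) (@continuous_monomial a).
have [Cf Cf0 fC] := csupp_bounded cf sf.
have [Cg Cg0 gC] := csupp_bounded cg sg.
have mF : measurable_fun setT (fun p : d.-tuple mR * d.-tuple mR => F p.1 p.2).
  apply: measurable_funM.
    apply: (measurableT_comp (measurable_rV_continuous (@continuous_monomial a))).
    exact: measurable_fst.
  apply: measurable_funM; last first.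
    by apply: (measurableT_comp (measurable_rV_continuous cg)); exact: measurable_snd.
  have := measurableT_comp (measurable_rV_continuous cf) measurable_tuple_sub.
  apply: eq_measurable_fun => -[s t] _ /=; congr f; apply/rowP => i.
  by rewrite !mxE tnth_mktuple.
have FC s t : `|F s t| <= Ca * (Cf * Cg) * (\1_(tbox P) s * \1_(tbox P) t).
  have [tN|Nt] := leP `|rV_of_tuple t| N; last first.
    by rewrite /F sg// !mulr0 normr0 !mulr_ge0.
  have [sM|Ms] := leP `|rV_of_tuple s - rV_of_tuple t| M; last first.
    by rewrite /F sf// !(mul0r, mulr0) normr0 !mulr_ge0.
  have tP : tbox P t.
    apply/tboxP => //; rewrite (le_lt_trans tN)// /P addrAC ltrDr ltr_wpDl//.
  have sMN : `|rV_of_tuple s| <= M + N.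
    rewrite -[rV_of_tuple s](subrK (rV_of_tuple t)) (le_trans (ler_normD _ _))//.
    exact: lerD.
  have sP : `|rV_of_tuple s| < P by rewrite (le_lt_trans sMN)// ltrDl.
  have sP' : tbox P s by apply/tboxP.
  rewrite !indicE !mem_set// !mulr1 /F !normrM !ler_pM ?mulr_ge0//.
  exact/aC/ltW.
transitivity (\int[mu]_s \int[mu]_t F s t)%R.
  apply: eq_Rintegral => s _; rewrite /convolution integral_rVE.
  rewrite -RintegralZl//; exact: (integrable_rV_conv _ cf sf cg).
rewrite (Rintegral_tuple_Fubini P0 mF FC).
transitivity (integral_rV (fun y => \sum_(r : {ffun 'I_d -> 'I_K})
   ((\prod_i 'C(a i, r i)%:R) * moment f (fun i => a i - r i)%N) * (monomial (fun i => r i) y * g y))).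
  rewrite integral_rVE; apply: eq_Rintegral => t _.
  set y := rV_of_tuple t.
  have i1 : integrable_rV (fun x => monomial a x * (f (x - y) * g y)).
    apply: (@integrable_rV_csupp _ _ (M + `|y|)).
      apply: continuous_mul; first exact: continuous_monomial.
      apply: continuous_mul; last by move=> z; exact: cst_continuous.
      move=> z; apply: (@continuous_comp _ _ _ (fun x => x - y) f); last exact: cf.
      by apply: (@continuousB _ _ _ id (cst y)); [exact: cvg_id|exact: cst_continuous].
    move=> x Mx; rewrite sf ?(mul0r, mulr0)//.
    rewrite -(ltrD2r `|y|) (lt_le_trans Mx)//.
    by rewrite -{1}[x](subrK y) ler_normD.
  (* Translation by [y], an affine substitution with factor 1, turns [f (x - y)] into [f x]. *)
  have := integral_rV_affine y (oner_neq0 R) i1.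
  rewrite normr1 invr1 expr1n mul1r => h.
  rewrite [LHS](esym h).
  have i2 (r : {ffun 'I_d -> 'I_K}) : integrable_rV (fun x => (\prod_i 'C(a i, r i)%:R * (monomial (fun i => r i) y * g y)) *
      (monomial (fun i => a i - r i)%N x * f x)).
    by apply: integrable_rVZ; exact: integrable_rV_moment sf.
  rewrite (_ : (fun x => _) = fun x => \sum_(r : {ffun 'I_d -> 'I_K})
     (\prod_i 'C(a i, r i)%:R * (monomial (fun i => r i) y * g y)) *
      (monomial (fun i => a i - r i)%N x * f x)); last first.
    apply/funext => x; rewrite scale1r [y + x]addrC addrK (monomialD_sum x y aK) mulr_suml.
    by apply: eq_bigr => r _; ring.
  rewrite (integral_rV_sum _ _ i2).2; apply: eq_bigr => r _.
  rewrite integral_rVZ; last exact: integrable_rV_moment sf.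
  by rewrite /moment; ring.
rewrite (integral_rV_sum _ _ _).2; last first.
  by move=> r; apply: integrable_rVZ; exact: integrable_rV_moment sg.
apply: eq_bigr => r _; rewrite integral_rVZ; last exact: integrable_rV_moment sg.
by rewrite mulrA.
Qed.

End Moments.

(** * Moments of derivatives *)

Section MomentPartial.
Context {R : realType} {d : nat}.
Implicit Types (f g : 'rV[R]_d -> R) (i : 'I_d) (x : 'rV[R]_d) (a : 'I_d -> nat) (s : seq 'I_d).
Local Notation e_ i := (delta_mx ord0 i : 'rV[R]_d).

Lemma is_derive_expn_shift (u : R) n :
  is_derive (0 : R) (1 : R) (fun h => (h + u) ^+ n) (n%:R * u ^+ n.-1).
Proof.
have h1 : is_derive (0 : R) (1 : R) (fun h : R => h + u) 1.
  by have := is_derive_add (is_derive_id (0 : R) (1 : R)) (is_derive_cst u (0 : R) (1 : R)); rewrite addr0.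
have := is_deriveX n h1; rewrite add0r [_%:A]mulr1.
by rewrite exprfctE.
Qed.

(** For [a i = 0] the truncated exponent is harmless, being multiplied by 0. *)
Lemma is_derive_monomial a i x :
  is_derive x (e_ i) (monomial a)
    ((a i)%:R * monomial (fun j => a j - (j == i))%N x).
Proof.
apply/is_derive_line.
pose c : R := \prod_(j < d | j != i) x ord0 j ^+ a j.
rewrite (_ : (fun h : R => _) = fun h : R => c * (h + x ord0 i) ^+ a i); last first.
  apply/funext => h; rewrite /monomial (bigD1 i)//= mulrC; congr (_ * _).
    by apply: eq_bigr => j ji; rewrite !mxE eqxx /= (negbTE ji) mulr0 add0r.
  by rewrite !mxE !eqxx mulr1.
rewrite /monomial (bigD1 i)//= eqxx subn1.
rewrite (_ : \prod_(j < d | j != i) _ = c); last first.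
  by apply: eq_bigr => j /negbTE ->; rewrite subn0.
rewrite mulrA [_ * c]mulrC.
exact: is_derive_scale (is_derive_expn_shift _ _).
Qed.

(** Integration by parts: the derivative of the monomial times [f] has integral zero. *)
Lemma moment_partial f M a i : 0 <= M -> smooth f -> csupp M f ->
  moment (partial i f) a = - ((a i)%:R * moment f (fun j => a j - (j == i))%N).
Proof.
move=> M0 sf cf; apply/eqP; rewrite -addr_eq0; apply/eqP.
have cm := @continuous_monomial R d.
have sc := smooth_continuous sf.
have sfi := smooth_partial i sf.
have dmf x : is_derive x (e_ i) (fun x => monomial a x * f x)
   (monomial a x * partial i f x + f x * ((a i)%:R * monomial (fun j => a j - (j == i))%N x)).
  apply: is_derive_mul; first exact: is_derive_monomial.
  exact/is_derive_partial/smooth_derivable.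
have pE : partial i (fun x => monomial a x * f x) =
   fun x => monomial a x * partial i f x + (a i)%:R * (monomial (fun j => a j - (j == i))%N x * f x).
  apply/funext => x; rewrite /partial; have [_ ->] := dmf x.
  by congr (_ + _); ring.
have := @integral_rV_partial R d (fun x => monomial a x * f x) i M M0.
rewrite pE; move=> <-.
- rewrite integral_rVD; last 2 first.
  + by apply: (integrable_rV_moment _ (smooth_continuous sfi)); exact: csupp_partial cf.
  + by apply: integrable_rVZ; exact: integrable_rV_moment sc cf.
  by rewrite integral_rVZ//; exact: integrable_rV_moment sc cf.
- exact: continuous_mul.
- by move=> x Mx; rewrite cf ?mulr0.
- by move=> x; have [] := dmf x.
- apply: continuous_add; first by apply: continuous_mul => //; exact: smooth_continuous.
  by apply: continuous_scale; exact: continuous_mul.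
Qed.

(** Repeated integration by parts. There are at least as many derivatives as powers, so the monomial
    is annihilated unless the directions in [s] match its exponents exactly; then the factorials
    remain. *)
Lemma moment_foldr f M s a : 0 <= M -> smooth f -> csupp M f ->
  (\sum_(i < d) a i <= size s)%N ->
  moment (foldr (@partial R d) f s) a =
  if [forall i, a i == count_mem i s] then
    (-1) ^+ size s * (\prod_(i < d) (a i)`!%:R) * integral_rV f else 0.
Proof.
move=> M0 sf cf; elim: s a => [|i s IH] a /=.
  rewrite leqn0 sum_nat_eq0 => /forallP a0.
  have -> : a = fun=> 0%N by apply/funext => j; have /eqP := a0 j.
  rewrite moment0 ifT; last by apply/forallP.
  by rewrite expr0 mul1r big1 ?mul1r.
move=> as_; rewrite (moment_partial _ _ M0 (smooth_foldr s sf) (csupp_foldr s cf)).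
(* Without a power of coordinate [i], the derivative in direction [i] annihilates the monomial, and
   the exponents do not match the list either. *)
have [ai0|ai0] := posnP (a i).
  rewrite ai0 mul0r oppr0 ifF//; apply/negP => /forallP/(_ i).
  by rewrite ai0 eqxx.
rewrite IH; last first.
  rewrite -ltnS (leq_trans _ as_)// (bigD1 i)//= eqxx [ltnRHS](bigD1 i)//=.
  rewrite subn1 -{2}(prednK ai0) addSn ltnS leq_add2l leq_sum// => j /negbTE ->.
  by rewrite subn0.
have -> : [forall j, a j - (j == i) == count_mem j s]%N = [forall j, a j == ((i == j) + count_mem j s)]%N.
  apply: eq_forallb => j; rewrite eq_sym [j == i]eq_sym; case: (i =P j) => [<-|_]; last by rewrite subn0 add0n eq_sym.
  by rewrite subn1 add1n -{2}(prednK ai0) eqSS eq_sym.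
case: ifP => _; last by rewrite mulr0 oppr0.
rewrite (bigD1 i)//= eqxx [in RHS](bigD1 i)//=.
rewrite (eq_bigr (fun j => (a j)`!%:R)); last first.
  by move=> j /negbTE ->; rewrite subn0.
have -> : (a i)`!%:R = (a i)%:R * (a i - 1)`!%:R :> R.
  by rewrite subn1 -natrM -{2}(prednK ai0) -factS prednK.
by rewrite exprS; ring.
Qed.

End MomentPartial.

(** * The Laplacian under dilation and convolution *)

Section Laplacian.
Context {R : realType} {d : nat}.
Implicit Types (f g : 'rV[R]_d -> R) (i : 'I_d) (x : 'rV[R]_d) (a : 'I_d -> nat) (s : seq 'I_d).
Local Notation D s f := (foldr (@partial R d) f s).

Lemma smooth0 : smooth (fun _ : 'rV[R]_d => 0 : R).
Proof.
apply: (@smooth_coind _ _ (fun h => h = fun=> 0)) => // _ ->; split.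
  by move=> x; exact: cst_continuous.
move=> i; split; first by move=> x; exact: derivable_cst.
by apply/funext => x; exact: derive_cst.
Qed.

Lemma smooth_sum (I : Type) (r : seq I) (F : I -> 'rV[R]_d -> R) :
  (forall j, smooth (F j)) -> smooth (fun x => \sum_(j <- r) F j x).
Proof.
move=> sF; elim: r => [|j r IH].
  rewrite (_ : (fun x => _) = fun=> 0); first exact: smooth0.
  by apply/funext => x; rewrite big_nil.
rewrite (_ : (fun x => _) = fun x => F j x + \sum_(j <- r) F j x).
  exact: (smoothD (sF j) IH).
by apply/funext => x; rewrite big_cons.
Qed.

Lemma convolution_sum f M (I : Type) (r : seq I) (F : I -> 'rV[R]_d -> R) :
  continuous f -> csupp M f -> (forall j, continuous (F j)) ->
  convolution f (fun x => \sum_(j <- r) F j x) = fun x => \sum_(j <- r) convolution f (F j) x.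
Proof.
move=> cf sf cF; apply/funext => x; rewrite /convolution.
rewrite -(integral_rV_sum _ _ _).2; last by move=> j; exact: integrable_rV_conv sf (cF j).
by congr integral_rV; apply/funext => y; rewrite mulr_sumr.
Qed.

Lemma smooth_laplacian f : smooth f -> smooth (laplacian f).
Proof. by move=> sf; apply: smooth_sum => i; do 2 apply: smooth_partial. Qed.

Lemma csupp_laplacian M f : csupp M f -> csupp M (laplacian f).
Proof.
by move=> sf x Mx; rewrite /laplacian big1// => i _; rewrite (csupp_partial i (csupp_partial i sf)).
Qed.

Lemma laplacianD f g : smooth f -> smooth g ->
  laplacian (fun x => f x + g x) = fun x => laplacian f x + laplacian g x.
Proof.
move=> sf sg; apply/funext => x; rewrite /laplacian -big_split/=.
apply: eq_bigr => i _; rewrite (partialD i sf sg).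
by rewrite (partialD i (smooth_partial i sf) (smooth_partial i sg)).
Qed.

Lemma laplacianZ c f : smooth f ->
  laplacian (fun x => c * f x) = fun x => c * laplacian f x.
Proof.
move=> sf; apply/funext => x; rewrite /laplacian mulr_sumr.
by apply: eq_bigr => i _; rewrite (partialZ c i sf) (partialZ c i (smooth_partial i sf)).
Qed.

Lemma foldr_partialZ c f s : smooth f ->
  D s (fun x => c * f x) = fun x => c * D s f x.
Proof.
move=> sf; elim: s => //= i s ->.
by rewrite (partialZ c i (smooth_foldr s sf)).
Qed.

Lemma foldr_partial_dilation c f s : smooth f ->
  D s (fun x => f (c *: x)) = fun x => c ^+ size s * D s f (c *: x).
Proof.
move=> sf; elim: s => [|i s IH] /=; first by apply/funext => x; rewrite mul1r.
have sD := smooth_foldr s sf.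
rewrite IH partialZ; last exact: smooth_dilation.
by rewrite partial_dilation//; apply/funext => x; rewrite exprS; ring.
Qed.

Lemma laplacian_dilation c f : smooth f ->
  laplacian (fun x => f (c *: x)) = fun x => c ^+ 2 * laplacian f (c *: x).
Proof.
move=> sf; apply/funext => x; rewrite /laplacian mulr_sumr.
apply: eq_bigr => i _.
have := foldr_partial_dilation c [:: i; i] sf; rewrite /= => h.
by rewrite [LHS](congr1 (fun F => F x) h).
Qed.

Lemma convolution_foldr f g M N s : 0 <= M -> 0 <= N ->
  smooth f -> csupp M f -> smooth g -> csupp N g ->
  convolution f (D s g) = D s (convolution f g).
Proof.
move=> M0 N0 sf cf sg cg; elim: s => //= i s <-.
exact: (convolution_partial i M0 N0 sf cf (smooth_foldr s sg) (csupp_foldr s cg)).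
Qed.

Lemma convolution_laplacian f g M N : 0 <= M -> 0 <= N ->
  smooth f -> csupp M f -> smooth g -> csupp N g ->
  convolution f (laplacian g) = laplacian (convolution f g).
Proof.
move=> M0 N0 sf cf sg cg; rewrite /laplacian.
rewrite (convolution_sum _ (smooth_continuous sf) cf); last first.
  by move=> i; apply/smooth_continuous/smooth_partial/smooth_partial.
apply/funext => x; apply: eq_bigr => i _.
by have := convolution_foldr [:: i; i] M0 N0 sf cf sg cg => /= ->.
Qed.

Lemma integral_rV_laplacian f M : 0 <= M -> smooth f -> csupp M f ->
  integral_rV (laplacian f) = 0.
Proof.
move=> M0 sf cf.
have sp i := smooth_partial i sf.
have cp i := csupp_partial i cf.
rewrite /laplacian (integral_rV_sum _ _ _).2; last first.
  move=> i; apply: (@integrable_rV_csupp _ _ M); last exact: csupp_partial.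
  exact: (smooth_continuous (smooth_partial i (sp i))).
rewrite big1// => i _; apply: (integral_rV_partial M0 (smooth_continuous (sp i)) (cp i)).
  by move=> x; exact: (smooth_derivable i x (sp i)).
exact: (smooth_continuous (smooth_partial i (sp i))).
Qed.
End Laplacian.

(** * Cancelling moments *)

Section Killing.
Context {R : realType} {d : nat}.
Implicit Types (f g phi rho psi chi : 'rV[R]_d -> R) (i : 'I_d) (x : 'rV[R]_d) (a b : 'I_d -> nat) (s : seq 'I_d).
Local Notation D s f := (foldr (@partial R d) f s).

(* [phi], [rho] and [psi] are [phi1], [rho] and [psi1] of the header. *)
Definition factor_triple chi (M : R) phi rho psi : Prop :=
  [/\ smooth phi /\ csupp M phi, smooth rho /\ csupp M rho & smooth psi /\ csupp M psi] /\
  [/\ integral_rV phi = 1, integral_rV rho = 1,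
      forall x, rho x - phi x = laplacian psi x &
      forall x, 2 ^+ d * convolution chi phi (2 *: x) = convolution chi rho x].

(** A list of directions, so that [foldr] of [partial] along it is the operator [D^a]. *)
Definition multiindex_seq a : seq 'I_d := flatten [seq nseq (a j) j | j <- enum 'I_d].

Lemma count_multiindex_seq a i : count_mem i (multiindex_seq a) = a i.
Proof.
rewrite /multiindex_seq count_flatten -map_comp sumnE big_map big_enum/=.
rewrite (bigD1 i)//= count_nseq /= eqxx mul1n big1 ?addn0// => j /negbTE ji.
by rewrite count_nseq /= ji.
Qed.

Lemma size_multiindex_seq a : size (multiindex_seq a) = (\sum_(i < d) a i)%N.
Proof.
rewrite /multiindex_seq size_flatten /shape -map_comp sumnE big_map big_enum/=.
by apply: eq_bigr => i _; rewrite size_nseq.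
Qed.

(** The correction with [S = c D^a]. Among the moments of order at most [|a|], those of [D^a rho]
    and [D^a phi] vanish except at [a] itself, where both equal [(-1)^|a| a!]. *)
Lemma kill_moment chi M0 M phi rho psi a :
  0 <= M0 -> smooth chi -> csupp M0 chi -> 0 <= M ->
  factor_triple chi M phi rho psi ->
  exists phi' rho' psi', [/\ factor_triple chi M phi' rho' psi',
    moment psi' a = 0 &
    forall b, (\sum_(i < d) b i <= \sum_(i < d) a i)%N -> ~ b =1 a ->
       moment psi' b = moment psi b].
Proof.
move=> M00 schi cchi M1 [[[sphi cphi] [srho crho] [spsi cpsi]] [iphi irho lapE convE]].
pose s := multiindex_seq a; pose k := size s.
(* The factor released when the dilation passes the [k] derivatives of [D^a] and the two of the
   Laplacian. *)
pose q : R := (2^-1) ^+ (k + 2).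
(* Solves [moment psi a + c (q - 1) (-1)^k a! = 0]; the denominator is nonzero because [q < 1]. *)
pose c : R := - moment psi a / ((q - 1) * ((-1) ^+ k * \prod_(i < d) (a i)`!%:R)).
have q1 : q - 1 != 0.
  rewrite subr_eq0 lt_eqF// /q exprn_ilt1 ?addn2//.
  by rewrite invf_lt1// ltr1n.
have fac0 : \prod_(i < d) (a i)`!%:R != 0 :> R.
  by apply/prodf_neq0 => i _; rewrite pnatr_eq0 -lt0n fact_gt0.
have sphis := smooth_foldr s sphi; have cphis := csupp_foldr s cphi.
have srhos := smooth_foldr s srho; have crhos := csupp_foldr s crho.
have slphi := smooth_laplacian sphis; have clphi := csupp_laplacian cphis.
have slrho := smooth_laplacian srhos; have clrho := csupp_laplacian crhos.
pose u := fun x => q * D s rho x + (-1) * D s phi x.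
have su : smooth u := smoothD (smoothZ q srhos) (smoothZ (-1) sphis).
have cu : csupp M u := csuppD (csuppZ q crhos) (csuppZ (-1) cphis).
exists (fun x => phi x + c * laplacian (D s phi) x).
exists (fun x => rho x + (c * q) * laplacian (D s rho) x).
exists (fun x => psi x + c * u x).
have sc := smooth_continuous.
have mu' b : moment (fun x => psi x + c * u x) b =
    moment psi b + c * (q * moment (D s rho) b - moment (D s phi) b).
  rewrite (momentD b (sc _ _ _ spsi) cpsi (sc _ _ _ (smoothZ c su)) (csuppZ c cu)).
  rewrite (momentZ c b (sc _ _ _ su) cu).
  rewrite (momentD b (sc _ _ _ (smoothZ q srhos)) (csuppZ q crhos) (sc _ _ _ (smoothZ (-1) sphis)) (csuppZ (-1) cphis)).
  rewrite (momentZ q b (sc _ _ _ srhos) crhos).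
  by rewrite (momentZ (-1) b (sc _ _ _ sphis) cphis) mulN1r.
have mle b : (\sum_(i < d) b i <= \sum_(i < d) a i)%N -> (\sum_(i < d) b i <= size s)%N.
  by rewrite size_multiindex_seq.
split.
- split.
    split; split.
    - exact: (smoothD sphi (smoothZ c slphi)).
    - exact: (csuppD cphi (csuppZ c clphi)).
    - exact: (smoothD srho (smoothZ (c * q) slrho)).
    - exact: (csuppD crho (csuppZ (c * q) clrho)).
    - exact: (smoothD spsi (smoothZ c su)).
    - exact: (csuppD cpsi (csuppZ c cu)).
  split.
  + rewrite integral_rVD; [|exact: integrable_rV_csupp (sc _ _ _ sphi) cphi|
      by apply: integrable_rVZ; exact: integrable_rV_csupp (sc _ _ _ slphi) clphi].
    rewrite integral_rVZ; last exact: integrable_rV_csupp (sc _ _ _ slphi) clphi.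
    by rewrite (integral_rV_laplacian M1 sphis cphis) mulr0 addr0.
  + rewrite integral_rVD; [|exact: integrable_rV_csupp (sc _ _ _ srho) crho|
      by apply: integrable_rVZ; exact: integrable_rV_csupp (sc _ _ _ slrho) clrho].
    rewrite integral_rVZ; last exact: integrable_rV_csupp (sc _ _ _ slrho) clrho.
    by rewrite (integral_rV_laplacian M1 srhos crhos) mulr0 addr0.
  + move=> x; rewrite (laplacianD spsi (smoothZ c su)) (laplacianZ c su).
    rewrite (laplacianD (smoothZ q srhos) (smoothZ (-1) sphis)).
    rewrite (laplacianZ q srhos) (laplacianZ (-1) sphis) -lapE.
    move: (rho x) (phi x) (laplacian _ x) (laplacian _ x) => r1 r2 r3 r4; ring.
  + have conv_chi g : smooth g -> csupp M g ->
      convolution chi (laplacian (D s g)) = laplacian (D s (convolution chi g)).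
      move=> sg cg.
      rewrite (convolution_laplacian M00 M1 schi cchi (smooth_foldr s sg) (csupp_foldr s cg)).
      by rewrite (convolution_foldr s M00 M1 schi cchi sg cg).
    have suc g (sg : smooth g) : smooth (convolution chi g) :=
      smooth_convolution M00 schi cchi (sc _ _ _ sg).
    have convA g e : smooth g -> csupp M g ->
      convolution chi (fun x => g x + e * laplacian (D s g) x) =
      fun x => convolution chi g x + e * laplacian (D s (convolution chi g)) x.
      move=> sg cg.
      have sl := smooth_laplacian (smooth_foldr s sg).
      rewrite (convolutionDr (sc _ _ _ schi) cchi (sc _ _ _ sg) (sc _ _ _ (smoothZ e sl))).
      rewrite (convolutionZr e (sc _ _ _ schi) cchi (sc _ _ _ sl)).
      by rewrite conv_chi.
    move=> x.
    have E1 := congr1 (fun F => F (2 *: x)) (convA phi c sphi cphi).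
    have E2 := congr1 (fun F => F x) (convA rho (c * q) srho crho).
    rewrite [X in _ * X]E1 [RHS]E2 -convE {E1 E2}.
    (* Both sides now involve the single function [convolution chi phi], and the powers of 2 from
       the dilation rules cancel against [q]. *)
    have -> : convolution chi rho = fun x => 2 ^+ d * convolution chi phi (2 *: x).
      by apply/funext => y; rewrite convE.
    have su2 := suc _ sphi.
    have sus := smooth_foldr s su2.
    rewrite (foldr_partialZ (2 ^+ d) s (smooth_dilation 2 su2)).
    rewrite (laplacianZ (2 ^+ d) (smooth_foldr s (smooth_dilation 2 su2))).
    rewrite (foldr_partial_dilation 2 s su2).
    rewrite (laplacianZ (2 ^+ size s) (smooth_dilation 2 sus)).
    rewrite (laplacian_dilation 2 sus).
    rewrite -/k mulrDr; congr (_ + _).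
    have qE : q * 2 ^+ k * 2 ^+ 2 = 1 by rewrite -mulrA -exprD /q -exprMn mulVf// expr1n.
    rewrite -[LHS]mul1r -{1}qE; ring.
- rewrite mu' (moment_foldr M1 srho crho) ?mle// (moment_foldr M1 sphi cphi) ?mle//.
  have -> : [forall i, a i == count_mem i s].
    by apply/forallP => i; rewrite count_multiindex_seq.
  rewrite iphi irho !mulr1 /c -/k.
  have n0 : (-1) ^+ k != 0 :> R by rewrite expf_neq0// oppr_eq0 oner_eq0.
  set P := (-1) ^+ k * _.
  have P0 : P != 0 by rewrite mulf_neq0.
  by field; apply/andP.
- move=> b ba nba; rewrite mu' (moment_foldr M1 srho crho) ?mle// (moment_foldr M1 sphi cphi) ?mle//.
  have -> : [forall i, b i == count_mem i s] = false.
    by apply/negP => /forallP h; apply: nba => i; rewrite (eqP (h i)) count_multiindex_seq.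
  by rewrite mulr0 subrr mulr0 addr0.
Qed.

End Killing.

(** * From a base pair to the factorization property *)

Section Final.
Context {R : realType} {d : nat}.
Implicit Types (f g phi rho psi chi : 'rV[R]_d -> R) (i : 'I_d) (x : 'rV[R]_d) (a b : 'I_d -> nat).

(** The orders are treated increasingly, since a correction preserves lower moments but may alter
    higher ones. *)
Lemma kill_moments chi M0 M phi rho psi (L : nat) :
  0 <= M0 -> smooth chi -> csupp M0 chi -> 0 <= M ->
  factor_triple chi M phi rho psi ->
  exists phi' rho' psi', factor_triple chi M phi' rho' psi' /\
    forall b, (\sum_(i < d) b i < L)%N -> moment psi' b = 0.
Proof.
move=> M00 schi cchi M1 tr; elim: L => [|L [phi1 [rho1 [psi1 [tr1 m1]]]]].
  by exists phi, rho, psi.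
(* Inner induction over the multi-indices of order [L], whose corrections leave each other's moments
   alone. The finite type also contains indices of other orders; these are skipped. *)
have step :
  forall A : seq {ffun 'I_d -> 'I_L.+1}, exists phi' rho' psi', [/\ factor_triple chi M phi' rho' psi',
    forall b, (\sum_(i < d) b i < L)%N -> moment psi' b = 0 &
    forall r : {ffun 'I_d -> 'I_L.+1}, r \in A -> (\sum_(i < d) r i = L)%N ->
      moment psi' (fun i => r i) = 0].
  elim=> [|r A [phi2 [rho2 [psi2 [tr2 m2 mA]]]]]; first by exists phi1, rho1, psi1.
  have [rL|rL] := eqVneq (\sum_(i < d) r i)%N L; last first.
    exists phi2, rho2, psi2; split => // r'; rewrite inE => /orP[/eqP ->|]; last exact: mA.
    by move=> h; rewrite h eqxx in rL.
  have [phi3 [rho3 [psi3 [tr3 m3 m3']]]] := kill_moment (fun i => r i) M00 schi cchi M1 tr2.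
  exists phi3, rho3, psi3; split => //.
    move=> b bL.
    have nb : ~ b =1 (fun i => r i).
      by move=> br; move: bL; rewrite (eq_bigr _ (fun i _ => br i)) rL ltnn.
    have br : (\sum_(i < d) b i <= \sum_(i < d) r i)%N by rewrite rL ltnW.
    by rewrite m3'// m2.
  move=> r' r'A r'L; have [->//|nr] := eqVneq r' r.
  have nb : ~ (fun i => r' i : nat) =1 (fun i => r i).
    by move=> h; move/eqP: nr; apply; apply/ffunP => i; apply/val_inj; exact: h.
  have r'r : (\sum_(i < d) r' i <= \sum_(i < d) r i)%N by rewrite rL r'L.
  by rewrite m3'// mA//; move: r'A; rewrite inE (negbTE nr).
have [phi2 [rho2 [psi2 [tr2 m2 m2']]]] := step (enum {ffun 'I_d -> 'I_L.+1}).
exists phi2, rho2, psi2; split => // b; rewrite ltnS leq_eqVlt => /orP[/eqP bL|]; last exact: m2.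
(* An index of order [L] has no entry above [L], so it occurs in the enumeration. *)
have bi i : (b i < L.+1)%N by rewrite ltnS -bL (bigD1 i)//= leq_addr.
pose r : {ffun 'I_d -> 'I_L.+1} := [ffun i => Ordinal (bi i)].
have -> : b = (fun i => r i) by apply/funext => i; rewrite ffunE.
apply: m2'; first by rewrite mem_enum.
by rewrite -[RHS]bL; apply: eq_bigr => i _; rewrite ffunE.
Qed.

Lemma csupp_dilation M c f : 0 < c -> csupp M f -> csupp (M / c) (fun x => f (c *: x)).
Proof.
move=> c0 cf x Mx; apply: cf; rewrite normrZ gtr0_norm//.
by rewrite mulrC -ltr_pdivrMr.
Qed.

Definition base_pair M phi psi : Prop :=
  [/\ smooth phi /\ csupp M phi, smooth psi /\ csupp M psi, integral_rV phi = 1 &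
      forall x, 2 ^+ d * phi (2 *: x) - phi x = laplacian psi x].

(** The bound on the supports doubles because [T^-1] stretches them by 2. *)
Lemma base_factor_triple M phi psi : 0 <= M -> base_pair M phi psi ->
  factor_triple phi (2 * M)
    (fun x => (2 ^+ d)^-1 * phi (2^-1 *: x)) (fun x => 2 ^+ d * phi (2 *: x))
    (fun x => psi x + 4 * ((2 ^+ d)^-1 * psi (2^-1 *: x))).
Proof.
move=> M0 [[sphi cphi] [spsi cpsi] iphi lapE].
have p20 : 2 ^+ d != 0 :> R by rewrite expf_neq0// pnatr_eq0.
have MM : M <= 2 * M by rewrite ler_peMl// ler1n.
have sc f (sf : smooth f) : continuous f := smooth_continuous sf.
have s2 := smooth_dilation 2 sphi; have sh := smooth_dilation 2^-1 sphi.
have t2 := smooth_dilation 2^-1 spsi.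
have half0 : 0 < 2^-1 :> R by rewrite invr_gt0.
have c2 : csupp (2 * M) (fun x => phi (2 *: x)).
  apply: (csuppW _ (csupp_dilation (ltr0Sn R 1) cphi)).
  by rewrite (le_trans _ MM)// ler_pdivrMr// ler_peMr// ler1n.
have ch : csupp (2 * M) (fun x => phi (2^-1 *: x)).
  by have := csupp_dilation half0 cphi; rewrite invrK mulrC.
have cpsih : csupp (2 * M) (fun x => psi (2^-1 *: x)).
  by have := csupp_dilation half0 cpsi; rewrite invrK mulrC.
have int_dil (c : R) : c != 0 -> integral_rV (fun x => phi (c *: x)) = `|c|^-1 ^+ d.
  move=> c0; have := integral_rV_affine 0 c0 (integrable_rV_csupp (sc _ sphi) cphi).
  rewrite iphi mulr1 => <-.
  by congr integral_rV; apply/funext => x; rewrite add0r.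
split.
  split; split.
  - exact: smoothZ sh.
  - exact: csuppZ ch.
  - exact: smoothZ s2.
  - exact: csuppZ c2.
  - exact: smoothD spsi (smoothZ 4 (smoothZ _ t2)).
  - exact: csuppD (csuppW MM cpsi) (csuppZ 4 (csuppZ _ cpsih)).
split.
- rewrite integral_rVZ; last exact: integrable_rV_csupp (sc _ sh) ch.
  by rewrite int_dil ?invr_neq0 ?pnatr_eq0// gtr0_norm// invrK mulVf.
- rewrite integral_rVZ; last exact: integrable_rV_csupp (sc _ s2) c2.
  by rewrite int_dil ?pnatr_eq0// ger0_norm// exprVn mulfV.
(* The equation of the pair is used at [x] for [T phi - phi] and at [x / 2] for [phi - T^-1 phi]. *)
- move=> x; rewrite (laplacianD spsi (smoothZ 4 (smoothZ _ t2))).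
  rewrite (laplacianZ 4 (smoothZ _ t2)) (laplacianZ _ t2) (laplacian_dilation _ spsi).
  rewrite -!lapE scalerA mulfV ?pnatr_eq0// scale1r.
  by field.
- move=> x; rewrite /convolution.
  have sq : smooth (fun y => (2 ^+ d)^-1 * phi (2^-1 *: y)) := smoothZ _ sh.
  have i1 := integrable_rV_conv (2 *: x) (sc _ sphi) cphi (sc _ sq).
  have n2 : - 2 != 0 :> R by rewrite oppr_eq0 pnatr_eq0.
  (* Substituting [2 x - 2 y] dilates and exchanges the two factors of the convolution at once. *)
  have := integral_rV_affine (2 *: x) n2 i1.
  rewrite normrN ger0_norm// exprVn => h.
  have i2 := integrable_rV_conv x (sc _ sphi) cphi (sc _ (smoothZ (2 ^+ d) s2)).
  have E : integral_rV (fun y => phi (2 *: x - (2 *: x + -2 *: y)) *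
        ((2 ^+ d)^-1 * phi (2^-1 *: (2 *: x + -2 *: y)))) =
      (2 ^+ d)^-1 ^+ 2 * integral_rV (fun y => phi (x - y) * (2 ^+ d * phi (2 *: y))).
    rewrite -integral_rVZ//; congr integral_rV; apply/funext => y.
    rewrite opprD addrA subrr add0r scaleNr opprK -scalerBr scalerA mulVf ?pnatr_eq0//.
    by rewrite scale1r; field.
  by move: h; rewrite E => /(congr1 (fun z => 2 ^+ d * (2 ^+ d * z))); rewrite mulVKf// => <-; field.
Qed.

Lemma laplacian0 : laplacian (fun _ : 'rV[R]_d => 0 : R) = fun=> 0.
Proof.
apply/funext => x; rewrite /laplacian big1// => i _.
have E : partial i (fun _ : 'rV[R]_d => 0 : R) = fun=> 0.
  by apply/funext => y; exact: derive_cst.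
by rewrite !E.
Qed.

Lemma integral_rV0 : integral_rV (fun _ : 'rV[R]_d => 0 : R) = 0.
Proof. by rewrite integral_rVE Rintegral_cst// mul0r. Qed.

Lemma supp_le M f : csupp M f -> supp f `<=` [set x | `|x| <= M].
Proof.
move=> cf.
have cK : closed [set x : 'rV[R]_d | `|x| <= M].
  rewrite (_ : [set x | _] = (fun x : 'rV[R]_d => `|x|) @^-1` [set y | y <= M])//.
  by apply: closed_comp => [x _|]; [exact: norm_continuous|exact: closed_le].
rewrite [X in _ `<=` X](closure_id _).1//; apply: closureS => x /=.
by apply: contraNT; rewrite -ltNge => /cf ->.
Qed.

Lemma csupp_test_fun M f : smooth f -> csupp M f -> test_fun f.
Proof.
move=> sf cf; split => //.
apply: subclosed_compact (@compact_norm_le R d M) (supp_le cf).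
exact: closed_closure.
Qed.

(* A compactly supported [f] with [f x = 2 ^ d f (2 x)] vanishes: look at a
   point where [|f|] is maximal. *)
Lemma dilation_invariant_eq0 M f : (0 < d)%N -> 0 <= M -> continuous f -> csupp M f ->
  (forall x, 2 ^+ d * f (2 *: x) = f x) -> f = fun=> 0.
Proof.
move=> d0 M0 cf sf inv.
have A0 : [set x : 'rV[R]_d | `|x| <= M] !=set0 by exists 0; rewrite /= normr0.
have cnf : continuous (fun y => `|f y|).
  by move=> y; apply: continuous_comp; [exact: cf|exact: norm_continuous].
have [c _ hc] := EVT_max_rV A0 (@compact_norm_le R d M) (continuous_subspaceT cnf).
have fc x : `|f x| <= `|f c|.
  have [xM|Mx] := leP `|x| M; first by apply: hc; rewrite inE.
  by rewrite sf ?normr0.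
have h : 2 ^+ d * `|f c| <= `|f c|.
  have := fc (2^-1 *: c); rewrite -inv scalerA mulfV ?pnatr_eq0// scale1r.
  by rewrite normrM ger0_norm.
have fc0 : `|f c| = 0.
  apply/eqP; rewrite eq_le normr_ge0 andbT leNgt; apply/negP => fc0.
  move: h; rewrite -[leRHS]mul1r ler_pM2r// leNgt => /negP; apply.
  by rewrite exprn_egt1 ?ltr1n// -lt0n.
apply/funext => x; apply/eqP; rewrite -normr_eq0 eq_le normr_ge0 andbT -fc0.
exact: fc.
Qed.

Lemma base_pair_MDFP M phi psi : (0 < d)%N -> 0 <= M -> base_pair M phi psi ->
  [/\ test_fun (fun _ : 'rV[R]_d => 0 : R), test_fun phi & MDFP (fun=> 0) phi].
Proof.
move=> d0 M0 bp.
have [[sphi cphi] _ iphi _] := bp.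
have sc f (sf : smooth f) : continuous f := smooth_continuous sf.
split; [exact: (@csupp_test_fun 0 _ smooth0 (fun _ _ => erefl))|exact: csupp_test_fun sphi cphi|].
(* [M] for the factor [phi] and [2 M] for the triple; neither involves [L]. *)
pose N := M + 2 * M.
have M20 : 0 <= 2 * M by rewrite mulr_ge0.
have N0 : 0 <= N by rewrite addr_ge0.
have MN : 2 * M <= N by rewrite lerDr.
exists [set x | `|x| <= N]; split; first exact: (@compact_norm_le R d N).
have tr0 := base_factor_triple M0 bp.
have /choice[T hT] (L : nat) : exists T : ('rV[R]_d -> R) * ('rV[R]_d -> R) * ('rV[R]_d -> R),
    factor_triple phi (2 * M) T.1.1 T.1.2 T.2 /\
    forall b, (\sum_(i < d) b i < L)%N -> moment T.2 b = 0.
  have [p [r [s [h1 h2]]]] := kill_moments L M0 sphi cphi M20 tr0.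
  by exists (p, r, s).
exists (fun L => convolution phi (T L).1.1), (fun L => (T L).1.1),
  (fun L => convolution phi (T L).2), (fun L => (T L).2) => L.
have [] := hT L; case: (T L) => -[/= phi1 rho1] psi1.
move=> [[[sp cp] [sr cr] [ss cs]] [ip ir lapE convE]] mom.
have sp0 := smooth_convolution M0 sphi cphi (sc _ sp).
have ss0 := smooth_convolution M0 sphi cphi (sc _ ss).
have cp0 := csupp_convolution cphi cp.
have cs0 := csupp_convolution cphi cs.
have conv0 g : convolution (fun=> 0) g = fun=> 0.
  apply/funext => x; rewrite /convolution -[RHS]integral_rV0; congr integral_rV.
  by apply/funext => y; rewrite mul0r.
have ip0 : integral_rV (convolution phi phi1) = 1.
  (* Taken as a moment of order 0, the integral becomes a sum with a single index. *)
  rewrite -moment0 (moment_convolution M0 M20 (sc _ sphi) cphi (sc _ sp) cp (fun=> ltn0Sn 0)).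
  have e1 : forall r : {ffun 'I_d -> 'I_1}, r = [ffun=> ord0].
    by move=> r; apply/ffunP => i; rewrite ffunE; exact: ord1.
  rewrite (bigD1 [ffun=> ord0])//= [X in _ + X]big1 ?addr0; last first.
    by move=> r; rewrite (e1 r) eqxx.
  rewrite [X in X * _]big1 ?mul1r; last by move=> i _; rewrite ffunE bin0.
  rewrite (_ : (fun i => 0 - _)%N = fun=> 0%N); last by apply/funext => i; rewrite sub0n.
  rewrite (_ : (fun i => nat_of_ord _) = fun=> 0%N); last by apply/funext => i; rewrite ffunE.
  by rewrite !moment0 iphi ip mulr1.
have scaleE x : 2 ^+ d * convolution phi phi1 (2 *: x) - convolution phi phi1 x
   = laplacian (convolution phi psi1) x.
  rewrite convE -(convolution_laplacian M0 M20 sphi cphi ss cs).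
  have -> : laplacian psi1 = fun x => rho1 x + (-1) * phi1 x.
    by apply/funext => y; rewrite -lapE mulN1r.
  rewrite (convolutionDr (sc _ sphi) cphi (sc _ sr) (sc _ (smoothZ (-1) sp))).
  by rewrite (convolutionZr (-1) (sc _ sphi) cphi (sc _ sp)) mulN1r.
have nz0 : convolution phi phi1 <> cst 0.
  by move=> h; move: ip0; rewrite h integral_rV0 => /eqP; rewrite eq_sym oner_eq0.
(* Otherwise [phi0] would be invariant under the dilation, hence zero, against its integral 1. The
   positivity of [d] enters here. *)
have nz1 : convolution phi psi1 <> cst 0.
  move=> h; apply: nz0; apply: (dilation_invariant_eq0 d0 N0 (sc _ sp0) cp0) => x.
  by apply/eqP; rewrite -subr_eq0 scaleE h laplacian0.
have mom0 a : (\sum_(i < d) a i < L)%N -> moment (convolution phi psi1) a = 0.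
  move=> aL.
  have aK i : (a i < (\sum_(i < d) a i).+1)%N by rewrite ltnS (bigD1 i)//= leq_addr.
  rewrite (moment_convolution M0 M20 (sc _ sphi) cphi (sc _ ss) cs aK).
  rewrite big1// => r _.
  (* Either [r <= a], and the moment of [psi1] has order below [L], or a binomial coefficient is
     zero. *)
  have [ra|/forallPn[i ri]] := boolP [forall i, r i <= a i]%N.
    rewrite (mom (fun i => r i)) ?mulr0// (leq_ltn_trans _ aL)//.
    by apply: leq_sum => i _; exact: (forallP ra).
  rewrite (_ : \prod_i _ = 0) ?mul0r//; apply/eqP; apply/prodf_eq0; exists i => //.
  by rewrite bin_small// ltnNge.
split.
  split.
  - split; split => //; [exact: supp_le cp0|exact: supp_le (csuppW MN cp)].
  - split; split.
    + by split => //; exact: supp_le cs0.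
    + exact: mom0.
    + by split => //; exact: supp_le (csuppW MN cs).
    + exact: mom.
  - split => //.
      by move=> h; move: ip; rewrite h integral_rV0 => /eqP; rewrite eq_sym oner_eq0.
    (* [psi1 = 0] would make its convolution with [phi] vanish, which is excluded. *)
    move=> h; apply: nz1; rewrite h; apply/funext => x.
    rewrite /convolution -[RHS]integral_rV0; congr integral_rV.
    by apply/funext => y; rewrite mulr0.
split => //; by move=> x; rewrite conv0 add0r.
Qed.

End Final.

(** * The base pair *)

Section Gen.
Context {R : realType} {V : normedModType R}.

(** The algebra generated by [A] and the constants. By the sum and product rules it is stable under
    differentiation once the derivatives of the generators lie in it, so smoothness is checked on
    generators. *)
Inductive gen (A : (V -> R) -> Prop) : (V -> R) -> Prop :=
| gen_base f : A f -> gen A f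
| gen_cst c : gen A (fun=> c)
| gen_add f g : gen A f -> gen A g -> gen A (fun x => f x + g x)
| gen_mul f g : gen A f -> gen A g -> gen A (fun x => f x * g x).

Lemma gen_continuous (A : (V -> R) -> Prop) : (forall f, A f -> continuous f) ->
  forall f, gen A f -> continuous f.
Proof.
move=> cA f; elim=> {f} [f /cA//|c|f g _ IHf _ IHg|f g _ IHf _ IHg].
- by move=> x; exact: cst_continuous.
- by move=> x; apply: (@continuousD _ _ _ f g); [exact: IHf|exact: IHg].
- by move=> x; apply: (@continuousM _ _ f g); [exact: IHf|exact: IHg].
Qed.

Lemma gen_is_derive (A : (V -> R) -> Prop) (v : V) :
  (forall f, A f -> exists2 g, gen A g & forall x, is_derive x v f (g x)) ->
  forall f, gen A f -> exists2 g, gen A g & forall x, is_derive x v f (g x).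
Proof.
move=> hA f; elim=> {f} [f /hA//|c|f g gf [f' hf df] gg [g' hg dg]|f g gf [f' hf df] gg [g' hg dg]].
- by exists (fun=> 0); [exact: gen_cst|move=> x; exact: is_derive_cst].
- exists (fun x => f' x + g' x); first exact: gen_add.
  by move=> x; exact: is_derive_add.
- exists (fun x => f x * g' x + g x * f' x).
    by apply: gen_add; exact: gen_mul.
  by move=> x; exact: is_derive_mul.
Qed.
End Gen.

(** * Smooth functions of one variable *)

Section Smooth1.
Context {R : realType}.
Implicit Types f g : R -> R.

Definition smooth1 f := forall n x, derivable (derive1n n f) x 1.

Lemma smooth1_coind (P : (R -> R) -> Prop) :
  (forall f, P f -> exists2 g, P g & forall x, is_derive x (1 : R) f (g x)) ->
  forall f, P f -> smooth1 f.
Proof.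
move=> hP f Pf n.
have step h : P h -> P ((derive1 h)) /\ forall x, derivable h x 1.
  move=> /hP[g Pg dg]; split; last by move=> x; have [] := dg x.
  by rewrite (_ : (derive1 h) = g)//; apply/funext => x; rewrite derive1E; have [] := dg x.
have Pn : P (derive1n n f) by elim: n => // n /step[]; rewrite derive1nS.
exact: (step _ Pn).2.
Qed.

Lemma smooth1_gen (A : (R -> R) -> Prop) :
  (forall f, A f -> exists2 g, gen A g & forall x, is_derive x (1 : R) f (g x)) ->
  forall f, gen A f -> smooth1 f.
Proof.
move=> hA; apply: smooth1_coind => f gf.
exact: (gen_is_derive hA gf).
Qed.

Lemma smooth1_derive f : smooth1 f -> smooth1 (derive1 f) /\ forall x, is_derive x (1 : R) f ((derive1 f) x).
Proof.
move=> sf; split => [n x|x]; first by rewrite -derive1Sn.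
by rewrite derive1E; apply: DeriveDef => //; exact: (sf 0%N).
Qed.

Lemma smooth1P f g : (forall x, is_derive x (1 : R) f (g x)) -> smooth1 g -> smooth1 f.
Proof.
move=> df sg; have E : (derive1 f) = g.
  by apply/funext => x; rewrite derive1E; have [] := df x.
by case=> [|n] x; [have [] := df x|rewrite derive1Sn E].
Qed.

Lemma smooth1_continuous f : smooth1 f -> continuous f.
Proof.
move=> sf x; apply: differentiable_continuous; apply/derivable1_diffP; exact: (sf 0%N).
Qed.

Let hsm f : smooth1 f -> exists2 g, gen smooth1 g & forall x, is_derive x (1 : R) f (g x).
Proof. by move=> /smooth1_derive[h1 h2]; exists (derive1 f) => //; exact: gen_base. Qed.

Lemma smooth1_cst c : smooth1 (fun=> c).
Proof. by apply: (smooth1_gen hsm); exact: gen_cst. Qed.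

Lemma smooth1_add f g : smooth1 f -> smooth1 g -> smooth1 (fun x => f x + g x).
Proof. by move=> sf sg; apply: (smooth1_gen hsm); apply: gen_add; exact: gen_base. Qed.

Lemma smooth1_mul f g : smooth1 f -> smooth1 g -> smooth1 (fun x => f x * g x).
Proof. by move=> sf sg; apply: (smooth1_gen hsm); apply: gen_mul; exact: gen_base. Qed.

Lemma smooth1_id : smooth1 id.
Proof. by apply: (smooth1P (g := fun=> 1)); exact: smooth1_cst. Qed.

Lemma is_derive_affine f g (a b x : R) : is_derive (a * x + b) (1 : R) f (g (a * x + b)) ->
  is_derive x (1 : R) (fun x => f (a * x + b)) (a * g (a * x + b)).
Proof.
move=> df; rewrite mulrC.
have h1 : is_derive x (1 : R) (fun x : R => a * x + b) a.
  have := is_derive_add (is_derive_scale a (is_derive_id x (1 : R))) (is_derive_cst b x (1 : R)).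
  by rewrite addr0 mulr1.
exact: (@is_derive1_comp _ f (fun x => a * x + b)).
Qed.

Lemma smooth1_affine f a b : smooth1 f -> smooth1 (fun x => f (a * x + b)).
Proof.
move=> sf; apply: (@smooth1_coind (fun h => exists f c, smooth1 f /\ h = fun x => c * f (a * x + b))); last first.
  by exists f, 1; split => //; apply/funext => x; rewrite mul1r.
move=> _ [{sf}f [c [sf ->]]]; have [sf' df] := smooth1_derive sf.
exists (fun x => c * (a * (derive1 f) (a * x + b))).
  by exists (derive1 f), (c * a); split => //; apply/funext => x; rewrite mulrA.
by move=> x; apply: is_derive_scale; exact: is_derive_affine.
Qed.

Lemma antiderivative g : continuous g -> (forall x, x <= 0 -> g x = 0) ->
  exists2 f, (forall x, is_derive x (1 : R) f (g x)) & forall x, x <= 0 -> f x = 0.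
Proof.
move=> cg g0.
(* Starting at -1 rather than 0 leaves the values unchanged and makes every [x >= 0] an inner point
   for the fundamental theorem of calculus. *)
pose f x := (\int[@lebesgue_measure R]_(t in `[(-1 : R), x]) g t)%R.
have f0 x : x <= 0 -> f x = 0.
  move=> x0; rewrite /f (@eq_Rintegral _ _ _ _ _ (fun=> 0 : R)).
    by rewrite Rintegral_cst// mul0r.
  by move=> t; rewrite inE /= in_itv/= => /andP[_ tx]; rewrite g0// (le_trans tx).
exists f => // x; have [x0|x0] := ltP x 0.
  rewrite g0; last exact: ltW.
  apply: (near_eq_is_derive _ (is_derive_cst (0 : R) x (1 : R))).
  have : \forall y \near x, y < 0 by exact: lt_nbhsl.
  by apply: filterS => y y0; rewrite f0// ltW.
have cgw u : {within `[(-1 : R), u], continuous g} by exact: continuous_subspaceT.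
have ig := continuous_compact_integrable (@segment_compact _ (-1) (x + 1)) (cgw (x + 1)).
have x1 : x < x + 1 by rewrite ltrDl.
have nx : -1 < x by rewrite (lt_le_trans _ x0)// ltrN10.
have [h1 h2] := continuous_FTC1_closed x1 ig nx (cg x).
by apply: DeriveDef; [exact: h1|rewrite -h2 derive1E].
Qed.

(* This family is closed under differentiation up to linear combinations, see
   [is_derive_flat]. *)
Definition flat n (x : R) : R := if 0 < x then x^-1 ^+ n * expR (- x^-1) else 0.

Lemma flat_ge0 n x : 0 <= flat n x.
Proof.
rewrite /flat; case: ifP => // x0.
by rewrite mulr_ge0 ?expR_ge0// exprn_ge0// invr_ge0 ltW.
Qed.

Lemma flat_gt0 n x : 0 < x -> 0 < flat n x.
Proof.
by move=> x0; rewrite /flat x0 mulr_gt0 ?expR_gt0// exprn_gt0// invr_gt0.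
Qed.

Lemma flat_le0 n x : x <= 0 -> flat n x = 0.
Proof. by rewrite /flat leNgt => /negbTE ->. Qed.

(** Quadratic smallness is what gives [flat n] the derivative 0 at the origin. With [m = n + 2] and
    [y = 1/x] it amounts to [(y/m)^m <= exp y]. *)
Lemma flat_bound n x : flat n x <= n.+2%:R ^+ n.+2 * x ^+ 2.
Proof.
have [x0|x0] := leP x 0.
  by rewrite flat_le0// mulr_ge0 ?sqr_ge0// exprn_ge0.
rewrite /flat x0; set y := x^-1.
have y0 : 0 < y by rewrite invr_gt0.
have m0 : 0 < n.+2%:R :> R by rewrite ltr0n.
(* The power of exponent [n + 2] of [u <= exp u], at [u = y / (n + 2)]. *)
have h : (y / n.+2%:R) ^+ n.+2 <= expR y.
  have -> : y = n.+2%:R * (y / n.+2%:R) by rewrite mulrC mulfVK// gt_eqF.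
  rewrite expRM_natl mulrC mulKf ?gt_eqF// lerXn2r ?nnegrE ?expR_ge0//.
    by rewrite divr_ge0// ltW.
  by rewrite (le_trans _ (expR_ge1Dx _))// lerDr.
rewrite expRN ler_pdivrMr ?expR_gt0//.
apply: (@le_trans _ _ (n.+2%:R ^+ n.+2 * x ^+ 2 * (y / n.+2%:R) ^+ n.+2)); last first.
  by rewrite ler_wpM2l// mulr_ge0// ?sqr_ge0// exprn_ge0.
have M0 : n.+2%:R ^+ n.+2 != 0 :> R by rewrite expf_neq0// gt_eqF.
have xy : x ^+ 2 * y ^+ 2 = 1 by rewrite -exprMn mulfV ?gt_eqF// expr1n.
rewrite expr_div_n; move: (n.+2%:R ^+ n.+2) M0 => M M0.
rewrite [leRHS](_ : _ = (x ^+ 2 * y ^+ 2) * y ^+ n); first by rewrite xy mul1r.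
by rewrite (exprS y n.+1) (exprS y n); field.
Qed.

Lemma is_derive_flat n x :
  is_derive x (1 : R) (flat n) (- n%:R * flat n.+1 x + flat n.+2 x).
Proof.
have [x0|x0|->] := ltgtP x 0.
- rewrite !flat_le0 ?ltW// mulr0 addr0.
  apply: (near_eq_is_derive _ (is_derive_cst (0 : R) x (1 : R))).
  have : \forall y \near x, y < 0 by exact: lt_nbhsl.
  by apply: filterS => y y0; rewrite flat_le0// ltW.
- have x0' : x != 0 by rewrite gt_eqF.
  have dV : is_derive x (1 : R) (fun y : R => y^-1) (- x^-1 ^+ 2).
    have h := is_deriveV x0' (is_derive_id x (1 : R)).
    by apply: is_derive_eq h _; rewrite [_%:A]mulr1 exprVn.
  have dX : is_derive x (1 : R) (fun y : R => y^-1 ^+ n) (n%:R * x^-1 ^+ n.-1 * - x^-1 ^+ 2).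
    by have := is_deriveX n dV; rewrite exprfctE.
  have dN : is_derive x (1 : R) (fun y : R => - y^-1) (x^-1 ^+ 2).
    by have := is_deriveN dV; rewrite opprK.
  have dE : is_derive x (1 : R) (expR \o (fun y : R => - y^-1)) (expR (- x^-1) * x^-1 ^+ 2).
    exact: is_derive1_comp.
  have dM := is_derive_mul dX dE.
  have dF : is_derive x (1 : R) (fun y : R => y^-1 ^+ n * expR (- y^-1))
      (- n%:R * flat n.+1 x + flat n.+2 x).
    rewrite /flat x0; apply: (is_derive_eq dM).
    (* For [n = 0] the truncated exponent [n.-1] meets the factor 0. *)
    by case: n {dX dM} => [|n] /=; rewrite !exprS ?expr0; ring.
  apply: (near_eq_is_derive _ dF).
  have : \forall y \near x, 0 < y by exact: lt_nbhsr.
  by apply: filterS => y y0; rewrite /flat y0.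
- rewrite !flat_le0// mulr0 addr0.
  (* By [flat_bound] the difference quotient at 0 is at most [C |h|]. *)
  have cvg0 : (fun h : R => h^-1 *: ((flat n \o shift 0) (h *: 1) - flat n 0)) @ 0^' --> (0 : R).
    pose C : R := n.+2%:R ^+ n.+2.
    have C0 : 0 <= C by rewrite exprn_ge0.
    apply: norm_cvg0.
    apply: (@squeeze_cvgr _ _ _ _ (cst 0) (fun h => C * `|h|)).
    + near=> h; rewrite normr_ge0/=.
      have h0 : h != 0 by near: h; exact: nbhs_dnbhs_neq.
      rewrite /= addr0 [h *: 1]mulr1 (flat_le0 n (lexx 0)) subr0 normrZ normfV.
      rewrite (ger0_norm (flat_ge0 _ _)) ler_pdivrMl ?normr_gt0//.
      rewrite [leRHS](_ : _ = C * h ^+ 2); first exact: flat_bound.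
      by rewrite mulrCA -expr2 real_normK// num_real.
    + exact: cvg_cst.
    + rewrite -[X in _ --> X](mulr0 C); apply: cvgMr.
      by rewrite -{2}(normr0 R); apply: cvg_norm; apply: cvg_within.
  apply: DeriveDef; first by apply/cvg_ex; exists 0.
  exact/cvg_lim.
Unshelve. all: by end_near. Qed.

Lemma smooth1_flat n : smooth1 (flat n).
Proof.
apply: (@smooth1_gen (fun f => exists n, f = flat n)); last by apply: gen_base; exists n.
move=> _ [{}n ->]; exists (fun x => - n%:R * flat n.+1 x + flat n.+2 x).
  apply: gen_add; last by apply: gen_base; exists n.+2.
  by apply: gen_mul; [exact: gen_cst|apply: gen_base; exists n.+1].
by move=> x; exact: is_derive_flat.
Qed.

End Smooth1.
Arguments smooth1_affine {R f} a b _ _ _.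

(** * Radial profiles *)

Section Profile.
Context {R : realType} (d : nat).
Implicit Types f g : R -> R.

Lemma is_derive0_eq f g a b : (forall x, is_derive x (1 : R) f (g x)) -> a <= b ->
  (forall x, x \in `]a, b[ -> g x = 0) -> f b = f a.
Proof.
move=> df ab g0.
have cf : continuous f.
  by move=> y; apply: differentiable_continuous; apply/derivable1_diffP; have [] := df y.
move: ab; rewrite le_eqVlt => /predU1P[->//|ab].
have [c cab h] := MVT ab (fun y _ => df y) (continuous_subspaceT cf).
by apply/eqP; rewrite -subr_eq0 h g0// mul0r.
Qed.

Lemma derive_vanish f (x : R) : (forall y, y < 1 -> f y = 0) -> x < 1 -> is_derive x (1 : R) f 0.
Proof.
move=> f0 x1; apply: (near_eq_is_derive _ (is_derive_cst (0 : R) x (1 : R))).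
have : \forall y \near x, y < 1 by exact: lt_nbhsl.
by apply: filterS => y y1; rewrite f0.
Qed.

(** A real power is singular at 0, but [f] vanishes below 1, so near any [x <= 0] the product is
    zero whatever value [powR] takes. *)
Lemma is_derive_mul_powR f f' a x : (forall y, y < 1 -> f y = 0) ->
  (forall y, is_derive y (1 : R) f (f' y)) ->
  is_derive x (1 : R) (fun x => f x * powR x a)
    (f x * (a * powR x (a - 1)) + powR x a * f' x).
Proof.
move=> f0 df; have [x0|x0] := ltP 0 x.
  exact: (is_derive_mul (df x) (is_derive1_powR a x0)).
have x1 : x < 1 by rewrite (le_lt_trans x0).
have -> : f' x = 0 by have [_ <-] := df x; have [_ ->] := derive_vanish f0 x1.
rewrite f0// mul0r mulr0 addr0; apply: derive_vanish => // y y1.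
by rewrite f0// mul0r.
Qed.

(** The products of this form, for all admissible [f] and [a], generate an algebra stable under
    differentiation. *)
Lemma smooth1_mul_powR f a : smooth1 f -> (forall x, x < 1 -> f x = 0) ->
  smooth1 (fun x => f x * powR x a).
Proof.
move=> sf f0; apply: (@smooth1_gen _ (fun h => exists f a,
  [/\ smooth1 f, (forall x, x < 1 -> f x = 0) & h = fun x => f x * powR x a])); last first.
  by apply: gen_base; exists f, a.
move=> _ [{sf f0}f [{}a [sf f0 ->]]]; have [sf' df] := smooth1_derive sf.
exists (fun x => a * (f x * powR x (a - 1)) + derive1 f x * powR x a).
  apply: gen_add.
    by apply: gen_mul; [exact: gen_cst|apply: gen_base; exists f, (a - 1)].
  apply: gen_base; exists (derive1 f), a; split => // x x1.
  by rewrite derive1E; have [_ ->] := derive_vanish f0 x1.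
move=> x; rewrite mulrCA [derive1 f x * _]mulrC; exact: is_derive_mul_powR.
Qed.

(** Positive precisely between 1 and 2; the arguments are spelled [a * t + b] to fit
    [smooth1_affine]. *)
Definition bump (t : R) : R := flat 0 (1 * t + -1) * flat 0 (-1 * t + 2).

Lemma smooth1_bump : smooth1 bump.
Proof. by apply: smooth1_mul; apply: smooth1_affine; exact: smooth1_flat. Qed.

Lemma bump_ge0 t : 0 <= bump t.
Proof. by rewrite mulr_ge0 ?flat_ge0. Qed.

Lemma bump_gt0 t : 1 < t < 2 -> 0 < bump t.
Proof. by move=> /andP[t1 t2]; rewrite mulr_gt0// flat_gt0//; lra. Qed.

Lemma bump_le1 t : t <= 1 -> bump t = 0.
Proof. by move=> t1; rewrite /bump flat_le0 ?mul0r//; lra. Qed.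

Lemma bump_ge2 t : 2 <= t -> bump t = 0.
Proof. by move=> t1; rewrite /bump mulrC flat_le0 ?mul0r//; lra. Qed.

(* [H s = s^(-d/2) eta s] is, up to a constant factor, the derivative of the
   Newtonian potential as a function of [s = |x|^2], cut off near [0]. *)
Lemma radial_profiles : exists Phi G1 G2 G3 : R -> R,
  [/\ smooth1 Phi, smooth1 G1,
      forall s, is_derive s (1 : R) G1 (G2 s) & forall s, is_derive s (1 : R) G2 (G3 s)] /\
  [/\ forall s, 2 <= s -> Phi s = 0, forall s, 2 <= s -> G1 s = 0,
      forall s, 0 <= Phi s, forall s, 1 < s < 2 -> 0 < Phi s &
      forall s, 4 * s * G3 s + 2 * d%:R * G2 s = 2 ^+ d * Phi (4 * s) - Phi s].
Proof.
have cb := smooth1_continuous smooth1_bump.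
have b0 t : t <= 0 -> bump t = 0 by move=> t0; rewrite bump_le1// (le_trans t0).
(* The cut-off: zero below 1 and constant from 2 on, not normalised to 1. *)
have [eta deta eta0] := antiderivative cb b0.
have seta := smooth1P deta smooth1_bump.
have eta1 t : t < 1 -> eta t = 0.
  move=> t1; have [t0|t0] := leP t 0; first exact: eta0.
  rewrite (is_derive0_eq deta (ltW t0)) ?eta0// => x; rewrite in_itv/= => /andP[_ xt].
  by rewrite bump_le1// ltW// (lt_trans xt).
have eta2 t : 2 <= t -> eta t = eta 2.
  move=> t2; rewrite (is_derive0_eq deta t2)// => x; rewrite in_itv/= => /andP[x2 _].
  by rewrite bump_ge2// ltW.
(* With this exponent [h = s^p] solves [4 s h' + 2 d h = 0], the equation for the derivative of a
   harmonic radial function of [s]. *)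
pose p : R := - (d%:R / 2).
pose H s := eta s * powR s p.
have sH : smooth1 H by exact: smooth1_mul_powR.
pose H' s := eta s * (p * powR s (p - 1)) + powR s p * bump s.
have dH s : is_derive s (1 : R) H (H' s) by exact: is_derive_mul_powR.
(* If [F' = H], this is the derivative of [2^(d-2) F(4 s) - F(s)], the profile of [psi] up to a
   constant. *)
pose K s := 2 ^+ d * H (4 * s + 0) + (-1) * H s.
have sK : smooth1 K.
  exact: (smooth1_add (smooth1_mul (@smooth1_cst R (2 ^+ d)) (smooth1_affine 4 0 sH))
    (smooth1_mul (@smooth1_cst R (-1)) sH)).
pose K' s := 2 ^+ d * (4 * H' (4 * s + 0)) + (-1) * H' s.
have dK s : is_derive s (1 : R) K (K' s).
  exact: (is_derive_add (is_derive_scale (2 ^+ d) (is_derive_affine (g := H') (dH (4 * s + 0))))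
    (is_derive_scale (-1) (dH s))).
have K0 s : s <= 0 -> K s = 0.
  by move=> s0; rewrite /K /H !eta1 ?mul0r ?mulr0 ?addr0//; lra.
(* Since [2^d 4^p = 1], the two homogeneous terms cancel where [eta] is constant; hence [psi] will
   have compact support. *)
have K2 s : 2 <= s -> K s = 0.
  move=> s2; rewrite /K /H addr0 eta2; last lra.
  rewrite (eta2 s)// powRM; [|lra..].
  have -> : powR 4 p = (2 ^+ d)^-1 :> R.
    rewrite (_ : 4 = powR 2 2); last by rewrite powR_mulrn// -natrX.
    by rewrite -powRrM /p mulrN mulrCA mulfV ?pnatr_eq0// mulr1 powRN powR_mulrn.
  have d0 : 2 ^+ d != 0 :> R by rewrite expf_neq0// pnatr_eq0.
  by field.
have [G dG G0] := antiderivative (smooth1_continuous sK) K0.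
have sG := smooth1P dG sK.
(* The first profile is the Laplacian of the cut-off potential. Beyond 2 the function [G] is
   constant, and subtracting [G 2] makes it vanish there. *)
exists (fun s => 4 * s * (bump s * powR s p)), (fun s => G s + (- G 2)), K, K'.
split.
  split.
  - have sbp := @smooth1_mul_powR bump p smooth1_bump (fun x x1 => bump_le1 (ltW x1)).
    exact: (smooth1_mul (smooth1_mul (@smooth1_cst R 4) smooth1_id) sbp).
  - exact: (smooth1_add sG (@smooth1_cst R (- G 2))).
  - move=> s; have := is_derive_add (dG s) (is_derive_cst (- G 2) s (1 : R)).
    by rewrite addr0.
  - exact: dK.
split.
- by move=> s s2; rewrite bump_ge2// mul0r mulr0.
- move=> s s2; rewrite (is_derive0_eq dG s2) ?subrr// => x; rewrite in_itv/= => /andP[x2 _].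
  by rewrite K2// ltW.
- move=> s; have [s0|s0] := leP s 0; first by rewrite b0// mul0r mulr0.
  by apply: mulr_ge0; apply: mulr_ge0; rewrite ?bump_ge0 ?powR_ge0// ltW.
- move=> s /[dup] s12 /andP[s1 s2]; have s0 : 0 < s by lra.
  by apply: mulr_gt0; apply: mulr_gt0; rewrite ?bump_gt0 ?powR_gt0.
- move=> s; rewrite /K /K' !addr0.
  (* The terms with [eta] cancel by the choice of [p]; only the derivative of the cut-off
     survives. *)
  have E u : 4 * u * H' u + 2 * d%:R * H u = 4 * u * (bump u * powR u p).
    have [u0|u0] := leP u 0; first by rewrite /H' /H b0// eta0//; ring.
    rewrite /H' /H (_ : powR u p = u * powR u (p - 1)).
      by move: (powR u (p - 1)) => w; rewrite /p; field.
    have pu : (1 + (p - 1) == 0) ==> (u != 0) by rewrite (gt_eqF u0) implybT.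
    by have := powRD pu; rewrite (addrC 1) subrK (powRr1 (ltW u0)).
  have := E (4 * s); have := E s => <- <-; ring.
Qed.

End Profile.

(** * Radial functions on row vectors *)

Section Radial.
Context {R : realType} {d : nat}.
Implicit Types (x : 'rV[R]_d) (i : 'I_d) (F : R -> R).
Local Notation e_ i := (delta_mx ord0 i : 'rV[R]_d).

Definition normsq x : R := \sum_(i < d) x ord0 i ^+ 2.

Lemma smooth_gen (A : ('rV[R]_d -> R) -> Prop) : (forall f, A f -> continuous f) ->
  (forall i f, A f -> exists2 g, gen A g & forall x, is_derive x (e_ i) f (g x)) ->
  forall f, gen A f -> smooth f.
Proof.
move=> cA dA; apply: smooth_coind => f gf; split; first exact: gen_continuous gf.
move=> i; have [g gg dg] := gen_is_derive (dA i) gf.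
split; first by move=> x; have [] := dg x.
by rewrite (_ : partial i f = g)//; apply/funext => x; rewrite /partial; have [] := dg x.
Qed.

Lemma is_derive_coord i j x :
  is_derive x (e_ i) (fun x : 'rV[R]_d => x ord0 j) (i == j)%:R.
Proof.
apply/is_derive_line.
rewrite (_ : (fun h : R => _) = fun h : R => (i == j)%:R * h + x ord0 j); last first.
  by apply/funext => h; rewrite !mxE eqxx /= eq_sym mulrC.
have := is_derive_add (is_derive_scale (i == j)%:R (is_derive_id (0 : R) (1 : R)))
  (is_derive_cst (x ord0 j) (0 : R) (1 : R)).
by rewrite addr0 mulr1.
Qed.

Lemma is_derive_radial F F' i x : (forall s, is_derive s (1 : R) F (F' s)) ->
  is_derive x (e_ i) (fun x => F (normsq x)) (2 * (x ord0 i * F' (normsq x))).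
Proof.
move=> dF; apply/is_derive_line.
(* The squared norm along the line is this polynomial, with slope [2 x_i] at 0. *)
pose u (h : R) := h * h + (2 * x ord0 i) * h + normsq x.
rewrite (_ : (fun h : R => _) = F \o u); last first.
  apply/funext => h /=; congr F.
  rewrite /u /normsq (bigD1 i)//= [in RHS](bigD1 i)//= !mxE !eqxx.
  rewrite (eq_bigr (fun j => x ord0 j ^+ 2)); last first.
    by move=> j ji; rewrite !mxE eqxx (negbTE ji) /= mulr0 add0r.
  by rewrite /= mulr1; ring.
have du : is_derive (0 : R) (1 : R) u (2 * x ord0 i).
  have did := is_derive_id (0 : R) (1 : R).
  have := is_derive_add (is_derive_add (is_derive_mul did did) (is_derive_scale (2 * x ord0 i) did))
    (is_derive_cst (normsq x) (0 : R) (1 : R)).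
  by rewrite !mul0r !add0r addr0 mulr1.
have u0 : u 0 = normsq x by rewrite /u !mulr0 !add0r.
have dF0 : is_derive (u 0) (1 : R) F (F' (normsq x)) by rewrite u0.
have := is_derive1_comp dF0 du.
by rewrite (_ : F' _ * _ = 2 * (x ord0 i * F' (normsq x)))//; ring.
Qed.

Lemma continuous_normsq : continuous normsq.
Proof.
rewrite /normsq; elim: (index_enum _) => [|j r IH].
  rewrite (_ : (fun x => _) = fun=> 0); first by move=> x; exact: cst_continuous.
  by apply/funext => x; rewrite big_nil.
rewrite (_ : (fun x => _) = fun x : 'rV[R]_d => x ord0 j ^+ 2 + \sum_(i <- r) x ord0 i ^+ 2); last first.
  by apply/funext => x; rewrite big_cons.
apply: continuous_add => // x.
apply: (@continuous_comp _ _ _ (fun x : 'rV[R]_d => x ord0 j) (fun y => y ^+ 2)).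
  exact: coord_continuous.
exact: exprn_continuous.
Qed.

(** Each differentiation of [F (|x|^2)] brings in a coordinate, so the coordinates are taken as
    generators beside the radial functions. *)
Lemma smooth_radial F : smooth1 F -> smooth (fun x => F (normsq x)).
Proof.
pose A f := (exists j, f = fun x : 'rV[R]_d => x ord0 j) \/
   exists2 F, smooth1 F & f = fun x => F (normsq x).
move=> sF; apply: (@smooth_gen A); last by apply: gen_base; right; exists F.
  move=> _ [[j ->]|[{sF}F sF ->]]; first by move=> x; exact: coord_continuous.
  move=> x; apply: (@continuous_comp _ _ _ normsq F); first exact: continuous_normsq.
  exact: smooth1_continuous.
move=> i _ [[j ->]|[{sF}F sF ->]].
  by exists (fun=> (i == j)%:R); [exact: gen_cst|move=> x; exact: is_derive_coord].
have [sF' dF] := smooth1_derive sF.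
exists (fun x => 2 * (x ord0 i * derive1 F (normsq x))); last first.
  by move=> x; exact: is_derive_radial.
apply: gen_mul; first exact: gen_cst.
apply: gen_mul; apply: gen_base; [by left; exists i|by right; exists (derive1 F)].
Qed.

Lemma laplacian_radial F F' F'' x : (forall s, is_derive s (1 : R) F (F' s)) ->
  (forall s, is_derive s (1 : R) F' (F'' s)) ->
  laplacian (fun x => F (normsq x)) x =
    4 * normsq x * F'' (normsq x) + 2 * d%:R * F' (normsq x).
Proof.
move=> dF dF'; rewrite /laplacian.
transitivity (\sum_(i < d) (4 * x ord0 i ^+ 2 * F'' (normsq x) + 2 * F' (normsq x))).
  apply: eq_bigr => i _.
  have -> : partial i (fun x => F (normsq x)) = fun x => 2 * (x ord0 i * F' (normsq x)).
    by apply/funext => y; rewrite /partial; have [] := is_derive_radial i y dF.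
  have [_ h] := is_derive_scale 2 (is_derive_mul (is_derive_coord i i x) (is_derive_radial i x dF')).
  by rewrite /partial h eqxx mulr1; ring.
rewrite big_split/= -mulr_suml -mulr_sumr -/(normsq x); congr (_ + _).
by rewrite sumr_const card_ord -mulr_natl; ring.
Qed.

(** Links the maximum norm of [csupp] with the Euclidean square of the profiles; 2 is a convenient
    radius, not the sharp one. *)
Lemma normsq_gt x : 2 < `|x| -> 2 <= normsq x.
Proof.
move=> x2; rewrite leNgt; apply/negP => q2; move: x2; rewrite ltNge => /negP; apply.
apply/rV_norm_le => // i; rewrite leNgt; apply/negP => xi.
have h : `|x ord0 i| ^+ 2 <= normsq x.
  rewrite real_normK ?num_real// /normsq (bigD1 i)//= lerDl sumr_ge0// => j _.
  exact: sqr_ge0.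
nra.
Qed.

Lemma normsq_dilation c x : normsq (c *: x) = c ^+ 2 * normsq x.
Proof.
by rewrite /normsq mulr_sumr; apply: eq_bigr => i _; rewrite mxE exprMn.
Qed.

(** By continuity [f] exceeds [f x0 / 2] on a cube around [x0], which has positive volume. *)
Lemma integral_rV_gt0 (f : 'rV[R]_d -> R) M x0 : continuous f -> csupp M f ->
  (forall x, 0 <= f x) -> 0 < f x0 -> 0 < integral_rV f.
Proof.
move=> cf sf f0 fx0.
have FF : Filter (nbhs x0) by exact: nbhs_filter.
have := @cvgr_gt _ _ _ FF _ _ (cf x0) (f x0 / 2).
rewrite ltr_pdivrMr// ltr_pMr// ltr1n => /(_ isT) /nbhs_ballP[e /= e0 hball].
pose B : set (d.-tuple (measurableTypeR R)) := [set t | forall i, `|x0 ord0 i - tnth t i| < e].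
have mB : measurable B by exact: measurable_tuple_ball.
have muB : lebesgue_tuple R d B = ((2 * e) ^+ d)%:E := lebesgue_tuple_ball x0 e0.
have iB : (lebesgue_tuple R d).-integrable setT (EFin \o (\1_B : _ -> R)).
  have := integrable_indic_tuple_ball x0 1 e0.
  by apply: eq_integrable => // t _ /=; rewrite mul1r.
apply: (@lt_le_trans _ _ (\int[lebesgue_tuple R d]_t (f x0 / 2 * \1_B t))%R).
  rewrite RintegralZl// mulr_gt0 ?divr_gt0// /Rintegral integral_indic// setIT.
  by rewrite [X in fine X]muB /= exprn_gt0// mulr_gt0.
rewrite integral_rVE; apply: le_Rintegral => //.
- exact: integrable_indic_tuple_ball.
- exact: integrable_rV_csupp sf.
- move=> t _; rewrite indicE; have [|] := boolP (t \in B); last by rewrite mulr0.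
  rewrite inE mulr1 => Bt; apply: ltW; apply: hball.
  rewrite -ball_normE /=; apply/rV_norm_lt => // i.
  by have := Bt i; rewrite !mxE.
Qed.

Lemma exists_base_pair : (0 < d)%N ->
  exists phi psi : 'rV[R]_d -> R, base_pair 2 phi psi.
Proof.
move=> d0.
have [Phi [G1 [G2 [G3 [[sPhi sG1 dG1 dG2] [Phi2 G12 Phi0 Phigt lapE]]]]]] := @radial_profiles R d.
pose f x := Phi (normsq x); pose g x := G1 (normsq x).
have sf : smooth f by exact: smooth_radial.
have sg : smooth g by exact: smooth_radial.
have cf : csupp 2 f by move=> x /normsq_gt; exact: Phi2.
have cg : csupp 2 g by move=> x /normsq_gt; exact: G12.
(* Any point with squared norm strictly between 1 and 2 would do, [Phi] being positive there;
   [d > 0] supplies the coordinate. *)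
pose x0 : 'rV[R]_d := \row_i (Num.sqrt (3 / 2) * (i == Ordinal d0)%:R).
have nx0 : normsq x0 = 3 / 2.
  rewrite /normsq (bigD1 (Ordinal d0))//= big1.
    by rewrite mxE eqxx mulr1 addr0 sqr_sqrtr// divr_ge0.
  by move=> i /negbTE ni; rewrite mxE ni mulr0 expr0n.
pose C := integral_rV f.
have C0 : 0 < C.
  apply: (integral_rV_gt0 (x0 := x0) (smooth_continuous sf) cf); first by move=> x; exact: Phi0.
  by rewrite /f nx0 Phigt//; lra.
exists (fun x => C^-1 * f x), (fun x => C^-1 * g x); split.
- by split; [exact: smoothZ sf|exact: csuppZ cf].
- by split; [exact: smoothZ sg|exact: csuppZ cg].
- rewrite integral_rVZ; last exact: integrable_rV_csupp (smooth_continuous sf) cf.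
  by rewrite mulVf// gt_eqF.
- move=> x; rewrite (laplacianZ C^-1 sg) (laplacian_radial x dG1 dG2) lapE.
  by rewrite /f normsq_dilation (_ : 2 ^+ 2 = 4); ring.
Qed.

End Radial.

Theorem proposition6p4 (R : realType) (d : nat) (hd : (0 < d)%N) :
  exists chi0 chi1 : 'rV[R]_d -> R,
    [/\ test_fun chi0, test_fun chi1 & MDFP chi0 chi1].
Proof.
have [phi [psi bp]] := @exists_base_pair R d hd.
exists (fun=> 0), phi; exact: base_pair_MDFP hd _ bp.
Qed.
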